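(* Let $\mathbf{L}\in Q(\mathbb{B}^n)$ and let $F:\mathbb{B}^n\to\mathbb{C}$ be an analytic function. If there exist $R',R''\in\mathbb{R}^n_+$ with $\mathbf{0}<R'<\mathbf{1}<R''$ (componentwise), $|R''|\le\beta$, and $p_1=p_1(R',R'')\ge1$ such that for every $z^0\in\mathbb{B}^n$ $$M\left(\frac{R''}{\mathbf{L}(z^0)},z^0,F\right)\le p_1\,M\left(\frac{R'}{\mathbf{L}(z^0)},z^0,F\right),$$ then $F$ is of bounded $\mathbf{L}$-index in joint variables.
   Context: $\mathbb{R}_+=[0,\infty)$, $\mathbb{Z}_+=\{0,1,2,\dots\}$, $\mathbf{0}=(0,\dots,0)$, $\mathbf{1}=(1,\dots,1)$; $A<B$ for vectors means $a_j<b_j$ for all $j$. $|\cdot|$ is the Euclidean norm on $\mathbb{C}^n$ (and on $\mathbb{R}^n$); $\mathbb{B}^n=\{z\in\mathbb{C}^n:|z|<1\}$. For $K\in\mathbb{Z}^n_+$: $\|K\|=k_1+\dots+k_n$, $K!=k_1!\cdots k_n!$, $A^K=a_1^{k_1}\cdots a_n^{k_n}$, and $F^{(K)}=\partial^{\|K\|}F/\partial z_1^{k_1}\cdots\partial z_n^{k_n}$. Quotients $A/B$ of vectors are componentwise. For $R=(r_1,\dots,r_n)\in\mathbb{R}^n_+$: $\mathbb{D}^n[z^0,R]=\{z:|z_j-z^0_j|\le r_j,\ j=1,\dots,n\}$, $\mathbb{T}^n(z^0,R)=\{z:|z_j-z^0_j|=r_j,\ j=1,\dots,n\}$, and $M(R,z^0,F)=\max\{|F(z)|:z\in\mathbb{T}^n(z^0,R)\}$.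 Fix a constant $\beta>\sqrt n$. Throughout, $\mathbf{L}(z)=(l_1(z),\dots,l_n(z))$, where each $l_j:\mathbb{B}^n\to\mathbb{R}_+$ is continuous and $l_j(z)>\beta/(1-|z|)$ for all $z\in\mathbb{B}^n$. (Then $\mathbb{D}^n[z^0,R/\mathbf{L}(z^0)]\subset\mathbb{B}^n$ whenever $z^0\in\mathbb{B}^n$, $|R|\le\beta$.) $Q(\mathbb{B}^n)$ is the class of such $\mathbf{L}$ satisfying, for all $R\in\mathbb{R}^n_+$ with $|R|\le\beta$ and all $j$, $0<\lambda_{1,j}(R)\le\lambda_{2,j}(R)<\infty$, where $\lambda_{1,j}(R)$ and $\lambda_{2,j}(R)$ are respectively the infimum and the supremum of $l_j(z)/l_j(z^0)$ over all $z^0\in\mathbb{B}^n$ and $z\in\mathbb{D}^n[z^0,R/\mathbf{L}(z^0)]$. An analytic $F:\mathbb{B}^n\to\mathbb{C}$ is of bounded $\mathbf{L}$-index in joint variables if there is $m\in\mathbb{Z}_+$ such that for all $z\in\mathbb{B}^n$ and $J\in\mathbb{Z}^n_+$: $\frac{|F^{(J)}(z)|}{J!\mathbf{L}^J(z)}\le\max\{\frac{|F^{(K)}(z)|}{K!\mathbf{L}^K(z)}:K\in\mathbb{Z}^n_+,\|K\|\le m\}$. *)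

(* Defs.v *)
From HB Require Import structures.
From mathcomp Require Import all_boot all_order all_algebra.
From mathcomp Require Import all_classical all_reals all_analysis.
From mathcomp Require Import complex.

Set Implicit Arguments.
Unset Strict Implicit.
Unset Printing Implicit Defensive.

Import Order.TTheory GRing.Theory Num.Theory.
Import numFieldNormedType.Exports.

Local Open Scope classical_set_scope.
Local Open Scope ring_scope.

(* [R[i]^o] is the field R[i] seen as a normed module over itself; this is what
   gives 'rV[C R]_n its topology (the usual one) and 'D_v its meaning of
   complex directional derivative. *)
Notation C R := (R[i]^o).

(* The library norm `|z| of z : R[i] lives in R[i]; cabs is its value in R. *)
Notation cabs := Normc.normc.

Definition mindex (n : nat) := {ffun 'I_n -> nat}.

Section Defs.
Variables (R : realType) (n : nat).
Implicit Types (z a : 'rV[C R]_n) (r s : 'rV[R]_n) (K J : mindex n)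
  (F : 'rV[C R]_n -> C R) (L : 'rV[C R]_n -> 'rV[R]_n).

(* The library norm of 'rV is the max norm, hence these Euclidean norms. *)
Definition cnorm2 z : R := Num.sqrt (\sum_j cabs (z ord0 j) ^+ 2).
Definition rnorm2 r : R := Num.sqrt (\sum_j r ord0 j ^+ 2).

Definition unit_ball : set 'rV[C R]_n := [set z | cnorm2 z < 1].

Definition vdiv r s : 'rV[R]_n := \row_j (r ord0 j / s ord0 j).

Definition polydisc a r : set 'rV[C R]_n :=
  [set z | forall j, cabs (z ord0 j - a ord0 j) <= r ord0 j].

Definition torus a r : set 'rV[C R]_n :=
  [set z | forall j, cabs (z ord0 j - a ord0 j) = r ord0 j].

(* For r >= 0 and F continuous on the torus, which is then nonempty and
   compact, this supremum is a maximum. *)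
Definition maxmod r a F : R := sup [set cabs (F z) | z in torus a r].

Definition mlength K : nat := (\sum_j K j)%N.
Definition mfact K : nat := (\prod_j (K j)`!)%N.
Definition rmonom r K : R := \prod_j r ord0 j ^+ K j.
Definition cmonom z K : C R := \prod_j z ord0 j ^+ K j.

(* The multi-indices with all entries < N. *)
Definition mindex_of (N : nat) (K : {ffun 'I_n -> 'I_N}) : mindex n :=
  [ffun j => nat_of_ord (K j)].

(* F^(K): the partial derivatives in the last variable are taken first. *)
Definition mderive F K : 'rV[C R]_n -> C R :=
  foldr (fun j G => iter (K j) (fun H => 'D_(delta_mx ord0 j) H) G)
    F (enum 'I_n).

(* F is analytic on A: around each point of A it is the sum of an absolutely
   convergent multiple power series. Absolute convergence makes the order of
   summation irrelevant; the sum is taken along the boxes [0, N[^n. *)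
Definition analytic_on (A : set 'rV[C R]_n) F : Prop :=
  forall a, A a -> exists (c : mindex n -> C R) (e : R), 0 < e /\
    forall z, (forall j, cabs (z ord0 j - a ord0 j) < e) ->
      summable [set: mindex n] (fun K => (cabs (c K * cmonom (z - a) K))%:E) /\
      (fun N : nat => \sum_(K : {ffun 'I_n -> 'I_N})
         c (mindex_of K) * cmonom (z - a) (mindex_of K)) @ \oo --> F z.

(* The set of all the quotients l_j(z) / l_j(z0) whose infimum and supremum are
   lambda_{1,j}(r) and lambda_{2,j}(r). *)
Definition ratios L (j : 'I_n) r : set (\bar R) :=
  [set x | exists z0 z, [/\ unit_ball z0, polydisc z0 (vdiv r (L z0)) z &
    x = (L z ord0 j / L z0 ord0 j)%:E]].

Definition lambda1 L j r : \bar R := ereal_inf (ratios L j r).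
Definition lambda2 L j r : \bar R := ereal_sup (ratios L j r).

Definition classQ (beta : R) L : Prop :=
  [/\ forall j, {within unit_ball, continuous (fun z => L z ord0 j)},
      forall z j, unit_ball z -> beta / (1 - cnorm2 z) < L z ord0 j &
      forall r, (forall j, 0 <= r ord0 j) -> rnorm2 r <= beta ->
        forall j, [/\ (0 < lambda1 L j r)%E,
          (lambda1 L j r <= lambda2 L j r)%E & (lambda2 L j r < +oo)%E]].

Definition index_term L F z K : R :=
  cabs (mderive F K z) / ((mfact K)%:R * rmonom (L z) K).

(* A multi-index of length at most m has entries < m.+1, so the max ranges over
   exactly the K with mlength K <= m; the terms are >= 0 on the ball, so the
   default value 0 is harmless. *)
Definition bounded_index L F : Prop :=
  exists m : nat, forall z J, unit_ball z ->
    index_term L F z J <=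
      \big[Num.max/0]_(K : {ffun 'I_n -> 'I_m.+1} | (mlength (mindex_of K) <= m)%N)
        index_term L F z (mindex_of K).

End Defs.

(* Main.v *)
Require Import Defs.
From mathcomp Require Import all_boot all_order all_algebra.
From mathcomp Require Import cyclic separable cyclotomic.
From mathcomp Require Import all_classical all_reals all_analysis.
From mathcomp Require Import complex ring lra.
Import Order.TTheory GRing.Theory Num.Theory.
Import numFieldNormedType.Exports.
Local Open Scope classical_set_scope.
Local Open Scope ring_scope.
Set Implicit Arguments.
Unset Strict Implicit.

(** Fix a point [z0] of the ball, write [l = L z0], let [c K] be the Taylor
    coefficients of [F] at [z0], so that [F^(K)(z0) = K! c K], and put
    [mu K = |c K| / l ^ K], which is the quantity compared in the definition of
    bounded index. Let [M''] and [M'] be the maxima of [|F|] on the tori of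
    multiradius [R'' / l] and [R' / l]. Both closed polydiscs lie in the ball
    because [l_j > beta / (1 - |z0|)] and [|R''| <= beta].

    Cauchy's estimate ([cauchy_estimate]) gives [mu K * R'' ^ K <= M'']. As the
    ratios [R'_j / R''_j] are bounded away from [1], the Taylor remainder of order
    [m] on the smaller torus is at most [M'' * G * q ^ (m + 1)], with [q < 1] and [G]
    independent of [z0] ([taylor_remainder]); hence
    [M' <= \sum_(|K| <= m) mu K + M'' * G * q ^ (m + 1)]. Insert this in
    [M'' <= p1 * M'] with [m] so large that the remainder contributes at most
    [M'' / 2]: then [M'' <= A * max_(|K| <= m) mu K], with [A] independent of [z0].
    Finally [mu J <= M'' / R'' ^ J] and [R''_j > 1], so for [J] long enough
    [mu J] is at most that same maximum.

    The function theory is obtained without integration and almost without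
    infinite series, from one local property: around each point of the ball, [F]
    has Peano expansions of all orders ([taylor]); these are read off from the
    power series once and for all ([analytic_taylor]).

    - A function of one complex variable with second-order Peano expansions has
      an approximate mean value property over the four points
      [t + s, t - s, t + i s, t - i s]. Therefore [|F| + eps * |z - a| ^ 2] has no
      maximum with an interior coordinate, which is the maximum principle on a
      polydisc relative to its torus ([maximum_principle]).
    - Dividing by a power of the variable yields Schwarz' lemma ([schwarz]), and
      with it the Cauchy estimate for a derivative ([cauchy_first]). This shows
      that Peano expansions may be differentiated ([taylor_dcoef]), and so
      identifies iterated partial derivatives with coefficients
      ([mderive_taylor]).
    - Averaging [F (z0 + t * v)] over the rotations of the coordinates of [v] by
      roots of unity isolates one monomial to any prescribed order in [t];
      Schwarz' lemma then gives Cauchy's estimate for its coefficient. The Taylor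
      remainder is Schwarz' lemma on complex lines through [z0]. *)

(** * The modulus of complex numbers *)

Section Modulus.
Context {R : realType}.
Implicit Types (x y : C R).

Lemma cabs_ge0 x : 0 <= cabs x.
Proof. by case: x => a b /=; rewrite sqrtr_ge0. Qed.

Lemma cnormE x : `|x| = (cabs x)%:C%C.
Proof. by []. Qed.

Lemma cabsD x y : cabs (x + y) <= cabs x + cabs y.
Proof. exact: le_normcD. Qed.

Lemma cabsM x y : cabs (x * y) = cabs x * cabs y.
Proof. exact: Normc.normcM. Qed.

Lemma cabsN x : cabs (- x) = cabs x.
Proof. exact: normcN. Qed.

Lemma cabsV x : cabs x^-1 = (cabs x)^-1.
Proof. exact: Normc.normcV. Qed.

Lemma cabs0 : cabs (0 : C R) = 0.
Proof. exact: Normc.normc0. Qed.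

Lemma cabs1 : cabs (1 : C R) = 1.
Proof. exact: Normc.normc1. Qed.

Lemma cabsX x k : cabs (x ^+ k) = cabs x ^+ k.
Proof. by elim: k => [|k IH]; rewrite ?expr0 ?cabs1 // !exprS cabsM IH. Qed.

Lemma cabs_prod (I : Type) (s : seq I) (f : I -> C R) :
  cabs (\prod_(i <- s) f i) = \prod_(i <- s) cabs (f i).
Proof. by elim/big_rec2: _ => [|i y x _ <-]; rewrite ?cabs1 // cabsM. Qed.

Lemma cabs_sum (I : Type) (s : seq I) (P : pred I) (f : I -> C R) :
  cabs (\sum_(i <- s | P i) f i) <= \sum_(i <- s | P i) cabs (f i).
Proof.
elim/big_rec2: _ => [|i y x _ le_xy]; first by rewrite cabs0.
by apply: le_trans (cabsD _ _) _; rewrite lerD2l.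
Qed.

Lemma cabsB_le x y : cabs x - cabs y <= cabs (x - y).
Proof. by rewrite lerBlDr; apply: le_trans (cabsD _ _); rewrite subrK. Qed.

Lemma cabs_subC x y : cabs (x - y) = cabs (y - x).
Proof. by rewrite -opprB cabsN. Qed.

Lemma cabs_dist x y : `|cabs x - cabs y| <= cabs (x - y).
Proof. by rewrite ler_distl lerBlDr -lerBlDl cabs_subC cabsB_le -lerBlDl cabs_subC cabsB_le. Qed.

Lemma cabs_eq0 x : (cabs x == 0) = (x == 0).
Proof. by apply/eqP/eqP => [/Normc.eq0_normc //|->]; exact: cabs0. Qed.

Lemma cabs_gt0 x : (0 < cabs x) = (x != 0).
Proof. by rewrite lt_def cabs_ge0 andbT cabs_eq0. Qed.

Lemma cabs_real (a : R) : cabs (a%:C%C : C R) = `|a|.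
Proof. by rewrite /= expr0n /= addr0 sqrtr_sqr. Qed.

Lemma cabs_i : cabs ('i%C : C R) = 1.
Proof. by rewrite /= expr0n /= add0r expr1n sqrtr1. Qed.

Lemma cabs_nat k : cabs (k%:R : C R) = k%:R.
Proof.
have -> : (k%:R : C R) = (k%:R : R)%:C%C by rewrite rmorph_nat.
by rewrite cabs_real ger0_norm.
Qed.

Lemma sqr_cabs x : cabs x ^+ 2 = complex.Re x ^+ 2 + complex.Im x ^+ 2.
Proof. by case: x => a b /=; rewrite sqr_sqrtr // addr_ge0 // sqr_ge0. Qed.

End Modulus.

(** * Topology of complex row vectors *)

Section Compactness.
Context {R : realType}.

Lemma nbhs_cabs (x : C R) (P : set (C R)) (d : R) : 0 < d ->
  (forall y, cabs (y - x) < d -> P y) -> nbhs x P.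
Proof.
move=> d0 dP; apply/nbhs_ballP; exists (d%:C)%C; first by rewrite /= ltcR.
by move=> y; rewrite -ball_normE /= cnormE ltcR cabs_subC; exact: dP.
Qed.

Lemma nbhs_rV_cabs n (x : 'rV[C R]_n) (P : set 'rV[C R]_n) (d : R) : 0 < d ->
  (forall y : 'rV[C R]_n, (forall j, cabs (y ord0 j - x ord0 j) < d) -> P y) -> nbhs x P.
Proof.
move=> d0 dP; apply/nbhs_ballP; exists (d%:C)%C; first by rewrite /= ltcR.
move=> y xy; apply: dP => j.
have [_ {}xy] := xy; have := xy ord0 j.
by rewrite -ball_normE /= cnormE ltcR cabs_subC.
Qed.

Lemma cabs_ReIm (a b : R) : cabs ((a +i* b)%C : C R) <= `|a| + `|b|.
Proof.
have -> : (a +i* b)%C = a%:C%C + 'i%C * b%:C%C :> C R by simpc.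
by apply: le_trans (cabsD _ _) _; rewrite cabsM cabs_i mul1r !cabs_real.
Qed.

Lemma cabs_Re_le (x : C R) : `|complex.Re x| <= cabs x.
Proof. by have := normc_ge_Re x; rewrite cnormE lecR. Qed.

Lemma cabs_Im_le (x : C R) : `|complex.Im x| <= cabs x.
Proof.
by rewrite -[leRHS]ger0_norm ?cabs_ge0 // -ler_sqr ?nnegrE // !real_normK ?num_real //
  sqr_cabs lerDr sqr_ge0.
Qed.

(** A closed disc is a closed subset of the continuous image of a real square,
    and segments are known to be compact. *)
Lemma compact_disc (x : C R) (d : R) : compact [set y : C R | cabs (y - x) <= d].
Proof.
pose f (u : R * R) : C R := x + (u.1 +i* u.2)%C.
have fc : continuous f.
  move=> u; apply/cvgrPdist_lt => /= e; rewrite ltcE /= => /andP[/eqP e_im e0].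
  have -> : e = (complex.Re e)%:C%C by case: e e_im {e0} => a b /= ->.
  exists (ball u.1 (complex.Re e / 2), ball u.2 (complex.Re e / 2)) => /=.
    by split; apply: nbhsx_ballx; rewrite divr_gt0.
  move=> t [/= t1 t2]; rewrite cnormE ltcR.
  have -> : f u - f t = ((u.1 - t.1) +i* (u.2 - t.2))%C.
    by rewrite /f opprD addrACA subrr add0r; simpc.
  apply: le_lt_trans (cabs_ReIm _ _) _; rewrite [ltRHS]splitr.
  by apply: ltrD; [move: t1|move: t2]; rewrite -ball_normE.
pose sq : set (R * R) := `[- d, d] `*` `[- d, d].
have sq_compact : compact sq by apply: compact_setX; exact: segment_compact.
have im_compact : compact (f @` sq).
  by apply: continuous_compact => //; exact: continuous_subspaceT.
apply: (subclosed_compact _ im_compact).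
  move=> y cl_y /=; rewrite leNgt; apply/negP => lt_dy.
  have [] := cl_y [set z | d < cabs (z - x)].
    apply: (@nbhs_cabs _ _ (cabs (y - x) - d)); first by rewrite subr_gt0.
    move=> z /=; have := cabsD (y - z) (z - x); rewrite addrA subrK cabs_subC.
    by rewrite (cabs_subC y z); lra.
  by move=> z [/= zd]; rewrite ltNge zd.
move=> y /= yd; exists (complex.Re (y - x), complex.Im (y - x)) => /=.
  split; rewrite /= in_itv /= -ler_norml; apply: le_trans yd.
    exact: cabs_Re_le.
  exact: cabs_Im_le.
by rewrite /f /=; case: (y) (x) => a b [c e]; simpc; rewrite !(addrC c, addrC e) !subrK.
Qed.

Lemma compact_polydisc n (a : 'rV[C R]_n) (r : 'rV[R]_n) : compact (polydisc a r).
Proof.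
apply: (@rV_compact (C R) n (fun j => [set y | cabs (y - a ord0 j) <= r ord0 j])).
by move=> j; exact: compact_disc.
Qed.

End Compactness.

(** * Second-order expansions in one complex variable *)

Section Jets.
Context {R : realType}.
Implicit Types (f g : C R -> C R) (p q : {poly C R}).

(** The degree of [p] is not bounded, so that jets can be added and multiplied
    without truncating polynomials; only the coefficients of degree at most 2
    are determined by [g]. *)
Definition jet g (t : C R) (p : {poly C R}) : Prop :=
  exists B d : R, 0 < d /\
    forall h, cabs h <= d -> cabs (g (t + h) - p.[h]) <= B * cabs h ^+ 3.

Definition has_jet g t := exists p, jet g t p.

Lemma horner_bounded p : exists2 B : R, 0 <= B &
  forall h, cabs h <= 1 -> cabs p.[h] <= B.
Proof.
exists (\sum_(i < size p) cabs p`_i); first by apply: sumr_ge0 => i _; exact: cabs_ge0.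
move=> h h1; rewrite horner_coef; apply: (le_trans (cabs_sum _ _ _)).
apply: ler_sum => i _; rewrite cabsM cabsX ler_piMr ?cabs_ge0 //.
by rewrite exprn_ile1 ?cabs_ge0.
Qed.

Lemma jet_bounds g t p : jet g t p -> exists B d : R, [/\ 0 <= B, 0 < d <= 1 &
  forall h, cabs h <= d -> cabs (g (t + h) - p.[h]) <= B * cabs h ^+ 3].
Proof.
move=> [B [d [d0 gp]]]; exists `|B|, (Num.min d 1); split => //.
  by rewrite lt_min d0 ltr01 /= ge_min lexx orbT.
move=> h; rewrite le_min => /andP[hd _]; apply: le_trans (gp h hd) _.
by rewrite ler_wpM2r ?exprn_ge0 ?cabs_ge0 ?ler_norm.
Qed.

Lemma jet_value g t p : jet g t p -> p.[0] = g t.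
Proof.
move=> [B [d [d0 /(_ 0)]]]; rewrite cabs0 expr0n mulr0 addr0 => /(_ (ltW d0)).
by rewrite le_eqVlt ltNge cabs_ge0 orbF cabs_eq0 subr_eq0 => /eqP.
Qed.

Lemma jetD f g t p q : jet f t p -> jet g t q -> jet (fun x => f x + g x) t (p + q).
Proof.
move=> [B [d [d0 fp]]] [B' [d' [d'0 gq]]]; exists (B + B'), (Num.min d d').
split=> [|h]; first by rewrite lt_min d0.
rewrite le_min => /andP[hd hd']; rewrite hornerD opprD addrACA mulrDl.
by apply: le_trans (cabsD _ _) _; rewrite lerD ?fp ?gq.
Qed.

Lemma jetM f g t p q : jet f t p -> jet g t q -> jet (fun x => f x * g x) t (p * q).
Proof.
move=> /jet_bounds[B [d [B0 /andP[d0 d1] fp]]] /jet_bounds[B' [d' [B'0 /andP[d'0 d'1] gq]]].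
have [P P0 pP] := horner_bounded p; have [Q Q0 qQ] := horner_bounded q.
exists (B * (B' + Q) + P * B'), (Num.min d d').
split=> [|h]; first by rewrite lt_min d0.
rewrite le_min => /andP[hd hd']; rewrite hornerM.
have h1 := le_trans hd d1; have h0 := cabs_ge0 h.
(* (p + e1)(q + e2) - p q = e1 (e2 + q) + p e2 *)
have -> : f (t + h) * g (t + h) - p.[h] * q.[h] =
  (f (t + h) - p.[h]) * ((g (t + h) - q.[h]) + q.[h]) + p.[h] * (g (t + h) - q.[h]).
  by ring.
apply: le_trans (cabsD _ _) _; rewrite !cabsM mulrDl; apply: lerD.
  rewrite mulrAC; apply: ler_pM; rewrite ?cabs_ge0 ?fp //.
  apply: le_trans (cabsD _ _) _; apply: lerD; last exact: qQ.
  apply: le_trans (gq h hd') _; rewrite ler_piMr // exprn_ile1 //.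
by rewrite -mulrA; apply: ler_pM; rewrite ?cabs_ge0 ?pP ?gq.
Qed.

Lemma jet_poly p t : jet (fun x => p.[x]) t (p \Po ('X + t%:P)).
Proof.
exists 0, 1; split=> // h _.
by rewrite horner_comp !hornerE (addrC h) subrr cabs0.
Qed.

Lemma has_jet_poly p t : has_jet (fun x => p.[x]) t.
Proof. by eexists; exact: jet_poly. Qed.

Lemma has_jetD f g t : has_jet f t -> has_jet g t -> has_jet (fun x => f x + g x) t.
Proof. by move=> [p fp] [q gq]; exists (p + q); exact: jetD. Qed.

Lemma has_jetM f g t : has_jet f t -> has_jet g t -> has_jet (fun x => f x * g x) t.
Proof. by move=> [p fp] [q gq]; exists (p * q); exact: jetM. Qed.

Lemma eq_has_jet f g t : f =1 g -> has_jet f t -> has_jet g t.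
Proof.
move=> fg [p [B [d [d0 fp]]]]; exists p, B, d; split=> // h hd.
by rewrite -fg fp.
Qed.

Lemma near_has_jet f g t (d : R) : 0 < d ->
  (forall h, cabs h <= d -> f (t + h) = g (t + h)) -> has_jet f t -> has_jet g t.
Proof.
move=> d0 fg [p [B [d' [d'0 fp]]]]; exists p, B, (Num.min d d').
split; first by rewrite lt_min d0.
by move=> h; rewrite le_min => /andP[hd hd']; rewrite -fg // fp.
Qed.

Lemma has_jetX f t k : has_jet f t -> has_jet (fun x => f x ^+ k) t.
Proof.
move=> ft; elim: k => [|k IH].
  by apply: eq_has_jet (has_jet_poly 1 t) => x; rewrite hornerE.
apply: eq_has_jet (has_jetM ft IH) => x.
by rewrite exprS.
Qed.

Lemma has_jetZ f a b t : has_jet f (a * t) -> has_jet (fun x => b * f (a * x)) t.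
Proof.
move=> /[dup] -[p /jet_bounds [B [d [B0 /andP[d0 d1] fp]]]] _.
exists (b%:P * (p \Po (a%:P * 'X))).
exists (cabs b * B * cabs a ^+ 3), (d / (1 + cabs a)); have a0 := cabs_ge0 a.
split=> [|h]; first by rewrite divr_gt0 //; lra.
rewrite ler_pdivlMr => [hd|]; last lra.
have -> : (b%:P * (p \Po (a%:P * 'X))).[h] = b * p.[a * h].
  by rewrite hornerM hornerC horner_comp hornerM hornerC hornerX.
rewrite -mulrBr cabsM mulrDr -(mulrA (cabs b * B)) -exprMn -(mulrA (cabs b)).
apply: ler_wpM2l; first exact: cabs_ge0.
rewrite -cabsM; apply: fp; rewrite cabsM.
by apply: le_trans hd; rewrite mulrC ler_wpM2l ?cabs_ge0 //; lra.
Qed.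

Lemma has_jet_inv t : t != 0 -> has_jet (fun x => x^-1) t.
Proof.
move=> t0; have ct0 : 0 < cabs t by rewrite cabs_gt0.
(* the geometric series up to degree 2, whose remainder is explicit *)
exists ((t^-1)%:P - (t^-1 ^+ 2)%:P * 'X + (t^-1 ^+ 3)%:P * 'X^2).
exists (cabs t^-1 ^+ 3 * 2 / cabs t), (cabs t / 2); split=> [|h hd]; first by rewrite divr_gt0.
have th : cabs t / 2 <= cabs (t + h) by have := cabsB_le t (- h); rewrite cabsN opprK; lra.
have th0 : t + h != 0 by rewrite -cabs_gt0; lra.
set q := (X in X.[h]).
have -> : q.[h] = t^-1 - t^-1 ^+ 2 * h + t^-1 ^+ 3 * h ^+ 2 by rewrite /q !hornerE.
have -> : (t + h)^-1 - (t^-1 - t^-1 ^+ 2 * h + t^-1 ^+ 3 * h ^+ 2) =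
  - (t^-1 ^+ 3 * (t + h)^-1 * h ^+ 3).
  by field; rewrite th0.
rewrite cabsN cabsM cabsM !cabsX; apply: ler_wpM2r; first by rewrite exprn_ge0 ?cabs_ge0.
rewrite -mulrA; apply: ler_wpM2l; first by rewrite exprn_ge0 ?cabs_ge0.
rewrite cabsV -invf_div lef_pV2 ?posrE ?divr_gt0 //; lra.
Qed.

End Jets.

(** * The maximum principle on a polydisc *)

Section MaximumPrinciple.
Context {R : realType}.
Implicit Types (g : C R -> C R).

Lemma jet_quadratic g t : has_jet g t -> exists b c (B d : R), [/\ 0 <= B, 0 < d &
  forall h, cabs h <= d -> cabs (g (t + h) - (g t + b * h + c * h ^+ 2)) <= B * cabs h ^+ 3].
Proof.
move=> [p gp]; have gt := jet_value gp.
have [B [d [B0 /andP[d0 d1] {}gp]]] := jet_bounds gp.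
have [Q Q0 qQ] := horner_bounded (drop_poly 3 p).
exists p`_1, p`_2, (B + Q), d; split=> // [|h hd]; first exact: addr_ge0.
have -> : g (t + h) - (g t + p`_1 * h + p`_2 * h ^+ 2) =
    (g (t + h) - p.[h]) + (drop_poly 3 p).[h] * h ^+ 3.
  rewrite -[in X in _ = _ - X + _](poly_take_drop 3 p) hornerD hornerM hornerXn.
  rewrite -gt horner_coef0 (horner_coef_wide _ (size_take_poly 3 p)).
  by rewrite !big_ord_recl big_ord0 !coef_take_poly /=; ring.
apply: le_trans (cabsD _ _) _; rewrite mulrDl; apply: lerD; first exact: gp.
by rewrite cabsM cabsX ler_wpM2r ?exprn_ge0 ?cabs_ge0 // qQ // (le_trans hd).
Qed.

(** The fourth roots of unity sum to [0], and so do their squares: the linear and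
    quadratic terms of the expansion cancel in the mean over [t + s x], [x ^ 4 = 1]. *)
Lemma four_point_mean g t : has_jet g t -> exists B d : R, [/\ 0 <= B, 0 < d &
  forall s : R, 0 <= s <= d -> 4 * cabs (g t) - B * s ^+ 3 <=
    cabs (g (t + s%:C%C)) + cabs (g (t - s%:C%C)) +
    cabs (g (t + 'i%C * s%:C%C)) + cabs (g (t - 'i%C * s%:C%C))].
Proof.
move=> /jet_quadratic[b [c [B [d [B0 d0 gd]]]]].
exists (4 * B), d; split=> // [|s /andP[s0 sd]]; first by rewrite mulr_ge0.
set x : C R := s%:C%C.
have cx : cabs x = s by rewrite cabs_real ger0_norm.
have ii : 'i%C * 'i%C = -1 :> C R by apply/eqP; rewrite eq_complex /=; simpc; rewrite ?eqxx.
have cix : cabs ('i%C * x : C R) = s by rewrite cabsM cabs_i mul1r.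
pose e h := g (t + h) - (g t + b * h + c * h ^+ 2).
have e_le h : cabs h = s -> cabs (e h) <= B * s ^+ 3.
  by move=> hs; rewrite -hs; apply: gd; rewrite hs.
have gE : g t *+ 4 = g (t + x) + g (t - x) + g (t + 'i%C * x) + g (t - 'i%C * x)
    - (e x + e (- x) + e ('i%C * x) + e (- ('i%C * x))).
  rewrite /e !sqrrN !exprMn (expr2 'i%C) ii; ring.
have -> : 4 * cabs (g t) = cabs (g t *+ 4) by rewrite normcMn mulr_natl.
rewrite gE lerBlDr; apply: le_trans (cabsD _ _) _; rewrite cabsN.
apply: lerD.
  by do 3 (apply: le_trans (cabsD _ _) _; rewrite lerD2r).
have -> : 4 * B * s ^+ 3 = B * s ^+ 3 + B * s ^+ 3 + B * s ^+ 3 + B * s ^+ 3 by ring.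
apply: le_trans (cabsD _ _) _; apply: lerD; last by apply: e_le; rewrite cabsN.
apply: le_trans (cabsD _ _) _; apply: lerD; last exact: e_le.
apply: le_trans (cabsD _ _) _; apply: lerD; last by apply: e_le; rewrite cabsN.
exact: e_le.
Qed.

(** Over the same four points the square of the modulus has a mean larger than its
    value at the centre by [s ^ 2], which dominates the [O(s ^ 3)] error in
    [four_point_mean]. *)
Lemma four_point_square (b : C R) (s : R) :
  cabs (b + s%:C%C) ^+ 2 + cabs (b - s%:C%C) ^+ 2 + cabs (b + 'i%C * s%:C%C) ^+ 2
  + cabs (b - 'i%C * s%:C%C) ^+ 2 = 4 * cabs b ^+ 2 + 4 * s ^+ 2.
Proof. by case: b => x y; rewrite !sqr_cabs; simpc => /=; ring. Qed.

(** Continuity stated with real radii, whereas the norm of a row vector of complex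
    numbers is an element of [C R]. *)
Definition cts n (F : 'rV[C R]_n -> C R) (a : 'rV[C R]_n) :=
  forall e : R, 0 < e -> exists2 d : R, 0 < d &
    forall z : 'rV[C R]_n, (forall j, cabs (z ord0 j - a ord0 j) < d) -> cabs (F z - F a) < e.

Lemma cts_continuous_cabs n (F : 'rV[C R]_n -> C R) a : cts F a ->
  (fun z => cabs (F z)) @ nbhs a --> cabs (F a).
Proof.
move=> Fa; apply/(@cvgrPdist_lt _ _ _ (nbhs a) _ (fun z => cabs (F z))) => e /Fa[d d0 Fd].
apply: (nbhs_rV_cabs d0) => z /Fd; apply: le_lt_trans.
by rewrite distrC; exact: cabs_dist.
Qed.

Lemma polydisc_center n (a : 'rV[C R]_n) (r : 'rV[R]_n) :
  (forall j, 0 <= r ord0 j) -> polydisc a r a.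
Proof. by move=> r0 j; rewrite subrr cabs0. Qed.

Lemma cts_coord n (a b : 'rV[C R]_n) j : cts (fun z : 'rV[C R]_n => z ord0 j - a ord0 j) b.
Proof.
move=> e e0; exists e => // z /(_ j).
by have -> : z ord0 j - b ord0 j = z ord0 j - a ord0 j - (b ord0 j - a ord0 j) by ring.
Qed.

Lemma cvg_sum_seq (T : Type) (E : set_system T) (FE : Filter E) (I : Type) (s : seq I)
    (f : I -> T -> R) (l : I -> R) : (forall i, f i x @[x --> E] --> l i) ->
  (\sum_(i <- s) f i x) @[x --> E] --> \sum_(i <- s) l i.
Proof.
move=> fl; elim: s => [|i s IH].
  by under eq_fun do rewrite big_nil; rewrite big_nil; exact: cvg_cst.
by under eq_fun do rewrite big_cons; rewrite big_cons; exact: cvgD.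
Qed.

(** For every [eps > 0] the function [u = |F| + eps * |z - a| ^ 2] attains its maximum
    over the compact polydisc at some [b]. If [b] had a coordinate [j] inside its
    disc, moving that coordinate to the four points at distance [s] of [b_j]
    would increase the mean of [u] by at least [eps * s ^ 2 - O(s ^ 3)]. So [b] is
    on the torus, and [eps] tends to [0]. *)
Lemma maximum_principle n (a : 'rV[C R]_n) (r : 'rV[R]_n) (F : 'rV[C R]_n -> C R) (M : R) :
  (forall j, 0 <= r ord0 j) ->
  (forall z, polydisc a r z -> cts F z) ->
  (forall z j, polydisc a r z -> has_jet (fun h => F (z + h *: delta_mx ord0 j)) 0) ->
  (forall z, torus a r z -> cabs (F z) <= M) ->
  forall z, polydisc a r z -> cabs (F z) <= M.
Proof.
move=> r0 Fcts Fjet FM z0 z0P.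
have a_in := polydisc_center a r0.
apply/ler_addgt0Pr => e e0; pose S := \sum_j r ord0 j ^+ 2.
have S0 : 0 <= S by apply: sumr_ge0 => j _; rewrite exprn_ge0.
pose eps := e / (1 + S).
have eps0 : 0 < eps by rewrite divr_gt0 //; lra.
have epsS : eps * S <= e by rewrite /eps -mulrA ler_piMr ?(ltW e0) // mulrC ler_pdivrMr; lra.
pose u (z : 'rV[C R]_n) := cabs (F z) + eps * \sum_j cabs (z ord0 j - a ord0 j) ^+ 2.
have [|||b /set_mem bP bmax] := @compact_EVT_max _ R u (polydisc a r).
- by exists a.
- exact: compact_polydisc.
- apply: continuous_in_subspaceT => z /set_mem zP.
  have Fz : Filter (nbhs z) by apply: nbhs_filter.
  apply: (@cvgD _ _ _ (nbhs z)); first exact: cts_continuous_cabs (Fcts z zP).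
  apply: (@cvgMl_tmp _ _ (nbhs z)).
  apply: (@cvg_sum_seq _ (nbhs z) _ _ (index_enum _)
    (fun j z => cabs (z ord0 j - a ord0 j) ^+ 2)) => j.
  rewrite /= expr2; apply: (@cvgM _ _ (nbhs z)); exact: cts_continuous_cabs (cts_coord a z j).
have {}bmax z : polydisc a r z -> u z <= u b by move=> zP; apply: bmax; exact: mem_set.
have [bT|/existsNP[j bj]] := pselect (torus a r b).
  apply: le_trans (_ : u z0 <= _).
    by rewrite /u lerDl mulr_ge0 ?(ltW eps0) // sumr_ge0 // => j _; rewrite exprn_ge0 ?cabs_ge0.
  apply: le_trans (bmax z0 z0P) _; apply: lerD; first exact: FM.
  apply: le_trans epsS; apply: ler_wpM2l; first exact: ltW.
  by apply: ler_sum => j _; rewrite bT.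
have {bj} bj : cabs (b ord0 j - a ord0 j) < r ord0 j by rewrite lt_neqAle bP andbT; exact/eqP.
have [B [d [B0 d0 Bd]]] := four_point_mean (Fjet b j bP).
pose m := Num.min d (r ord0 j - cabs (b ord0 j - a ord0 j)).
have m0 : 0 < m by rewrite lt_min d0 subr_gt0.
(* small enough for the four points to stay in the polydisc, and for B s < eps *)
pose s := Num.min m (eps / (1 + B)).
have s0 : 0 < s by rewrite lt_min m0 divr_gt0 //; lra.
have sm : s <= m by rewrite /s ge_min lexx.
have sB : s * (1 + B) <= eps by rewrite -ler_pdivlMr; [rewrite /s ge_min lexx orbT|lra].
have sd : s <= d by apply: le_trans sm _; rewrite /m ge_min lexx.
have sr : s + cabs (b ord0 j - a ord0 j) <= r ord0 j.
  by rewrite -lerBrDr; apply: le_trans sm _; rewrite /m ge_min lexx orbT.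
pose T := \sum_(i | i != j) cabs (b ord0 i - a ord0 i) ^+ 2.
have coord h i : (b + h *: delta_mx ord0 j) ord0 i - a ord0 i =
    b ord0 i - a ord0 i + (if i == j then h else 0).
  by rewrite !mxE eqxx /=; case: eqP => _; rewrite ?mulr1 ?mulr0; ring.
have uE h : u (b + h *: delta_mx ord0 j) = cabs (F (b + h *: delta_mx ord0 j)) +
    eps * (cabs (b ord0 j - a ord0 j + h) ^+ 2 + T).
  rewrite /u (bigD1 j) //= coord eqxx; congr (_ + _ * (_ + _)).
  by apply: eq_bigr => i /negbTE ij; rewrite coord ij addr0.
have ubE : u b = cabs (F b) + eps * (cabs (b ord0 j - a ord0 j) ^+ 2 + T).
  by rewrite /u (bigD1 j).
pose f h := cabs (F (b + h *: delta_mx ord0 j)).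
pose q h := cabs (b ord0 j - a ord0 j + h) ^+ 2.
have le_ub h : cabs h = s -> f h + eps * (q h + T) <= u b.
  move=> hs; rewrite -uE; apply: bmax => i; rewrite coord.
  case: eqP => [->|_]; last by rewrite addr0.
  by apply: le_trans (cabsD _ _) _; rewrite hs addrC.
set x : C R := s%:C%C.
have cs : cabs x = s by rewrite cabs_real ger0_norm ?ltW.
have cis : cabs ('i%C * x : C R) = s by rewrite cabsM cabs_i mul1r.
have sum_q : q x + q (- x) + q ('i%C * x) + q (- ('i%C * x)) =
    4 * cabs (b ord0 j - a ord0 j) ^+ 2 + 4 * s ^+ 2.
  exact: four_point_square.
have mean_f : 4 * cabs (F b) - B * s ^+ 3 <= f x + f (- x) + f ('i%C * x) + f (- ('i%C * x)).
  have := Bd s; rewrite (ltW s0) sd => /(_ isT).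
  by rewrite !(add0r (_ : C R)) scale0r addr0.
have f1 := le_ub x cs; have f3 := le_ub _ cis.
have f2 : f (- x) + eps * (q (- x) + T) <= u b by apply: le_ub; rewrite cabsN.
have f4 : f (- ('i%C * x)) + eps * (q (- ('i%C * x)) + T) <= u b by apply: le_ub; rewrite cabsN.
rewrite ubE in f1 f2 f3 f4.
move: (q x) (q (- x)) (q ('i%C * x)) (q (- ('i%C * x))) (f x) (f (- x)) (f ('i%C * x))
  (f (- ('i%C * x))) (cabs (F b)) (cabs (b ord0 j - a ord0 j) ^+ 2) sum_q mean_f f1 f2 f3 f4.
move=> q1 q2 q3 q4 g1 g2 g3 g4 g0 q0 sum_q mean_f f1 f2 f3 f4.
have s2 : 0 < s ^+ 2 by rewrite exprn_gt0.
have sum_eps : eps * (q1 + q2 + q3 + q4) = eps * (4 * q0 + 4 * s ^+ 2) by rewrite sum_q.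
have le1 : 4 * (eps * s ^+ 2) <= B * s ^+ 3 by lra.
have le2 : s ^+ 2 * (s * (1 + B)) <= s ^+ 2 * eps by rewrite ler_pM2l.
have s3 : 0 < s ^+ 3 by rewrite exprn_gt0.
have es : 0 < eps * s ^+ 2 by rewrite mulr_gt0.
by exfalso; move: le1 le2 s3 es; rewrite !exprS expr0; lra.
Qed.

End MaximumPrinciple.

(** * Schwarz' lemma in the unit disc *)

Section Disc.
Context {R : realType}.
Implicit Types (g : C R -> C R).

Lemma has_jet_shift g t : has_jet g t -> has_jet (fun h => g (t + h)) 0.
Proof.
move=> [p [B [d [d0 gp]]]]; exists p, B, d; split=> // h hd.
by rewrite add0r gp.
Qed.

Lemma has_jet_cts g t : has_jet g t -> forall e : R, 0 < e ->
  exists2 d : R, 0 < d & forall s, cabs (s - t) < d -> cabs (g s - g t) < e.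
Proof.
move=> /jet_quadratic[b [c [B [d [B0 d0 gd]]]]] e e0.
pose K := B + cabs b + cabs c.
have K0 : 0 <= K by rewrite !addr_ge0 ?cabs_ge0.
have b0 := cabs_ge0 b; have c0 := cabs_ge0 c.
exists (Num.min (Num.min d 1) (e / (1 + K))).
  by rewrite !lt_min d0 ltr01 /= divr_gt0 //; lra.
move=> s; rewrite !lt_min => /andP[/andP[sd s1]]; rewrite ltr_pdivlMr => [se|]; last lra.
set h := s - t in sd s1 se; have h0 := cabs_ge0 h.
have -> : g s - g t = (g (t + h) - (g t + b * h + c * h ^+ 2)) + (b * h + c * h ^+ 2).
  by rewrite (_ : t + h = s) /h; ring.
apply: le_lt_trans se; apply: le_trans (cabsD _ _) _.
have le_h k : (0 < k)%N -> cabs h ^+ k <= cabs h.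
  by case: k => // k _; rewrite exprS ler_piMr // exprn_ile1 // ltW.
have := gd h (ltW sd); have := cabsD (b * h) (c * h ^+ 2); rewrite (cabsM b) (cabsM c) cabsX.
have := ler_wpM2l B0 (@le_h 3%N isT); have := ler_wpM2l c0 (@le_h 2%N isT).
rewrite /K; lra.
Qed.

(** The maximum principle in the unit disc, seen as a polydisc in dimension 1. *)
Lemma disc_maximum g (M : R) : (forall t, cabs t <= 1 -> has_jet g t) ->
  (forall t, cabs t = 1 -> cabs (g t) <= M) -> forall t, cabs t <= 1 -> cabs (g t) <= M.
Proof.
move=> gjet gM t t1.
pose F (z : 'rV[C R]_1) := g (z ord0 ord0).
pose r : 'rV[R]_1 := const_mx 1; pose a : 'rV[C R]_1 := 0.
have inP (z : 'rV[C R]_1) : polydisc a r z -> cabs (z ord0 ord0) <= 1.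
  by move=> /(_ ord0); rewrite !mxE subr0.
rewrite -[t](mxE matrix_key (fun _ _ => t) (ord0 : 'I_1) (ord0 : 'I_1)).
apply: (@maximum_principle _ _ a r F M) => [j|z zP|z j zP|z zT|j].
- by rewrite mxE.
- move=> e e0; have [d d0 gd] := has_jet_cts (gjet _ (inP z zP)) e0.
  by exists d => // y /(_ ord0); exact: gd.
- apply: eq_has_jet (has_jet_shift (gjet _ (inP z zP))) => h.
  by rewrite /F !mxE !ord1 !eqxx mulr1.
- by apply: gM; have := zT ord0; rewrite !mxE subr0.
- by rewrite !mxE subr0.
Qed.

(** The maximum principle applied to [g t / t ^+ k]. The order [k + 3] at [0] is what
    makes this quotient, completed by [p.[0]] at [0], have a jet there. The bound on
    [p.[0]] is Cauchy's estimate for the leading coefficient. *)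
Lemma schwarz g k (p : {poly C R}) (M : R) :
  (forall t, cabs t <= 1 -> has_jet g t) ->
  (exists B d : R, 0 < d /\
     forall h, cabs h <= d -> cabs (g h - h ^+ k * p.[h]) <= B * cabs h ^+ (k + 3)) ->
  (forall t, cabs t = 1 -> cabs (g t) <= M) ->
  cabs p.[0] <= M /\ forall t, cabs t <= 1 -> cabs (g t) <= M * cabs t ^+ k.
Proof.
move=> gjet [B [d [d0 gB]]] gM.
have B0 : 0 <= B.
  have := gB d%:C%C; rewrite cabs_real gtr0_norm // lexx => /(_ isT) /(le_trans (cabs_ge0 _)).
  by rewrite pmulr_lge0 // exprn_gt0.
have g0 : g 0 = 0 ^+ k * p.[0].
  have := gB 0; rewrite cabs0 (ltW d0) addn3 [in leRHS]expr0n mulr0 => /(_ isT).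
  by rewrite le_eqVlt ltNge cabs_ge0 orbF cabs_eq0 subr_eq0 => /eqP.
pose f t := if t == 0 then p.[0] else t^-1 ^+ k * g t.
have gE t : g t = t ^+ k * f t.
  rewrite /f; case: eqP => [->|/eqP t0]; first exact: g0.
  by rewrite mulrA -exprMn mulfV // expr1n mul1r.
have fjet t : cabs t <= 1 -> has_jet f t.
  move=> t1; have [->|t0] := eqVneq t 0.
    exists p, B, d; split=> // h hd; rewrite add0r.
    have [->|h0] := eqVneq h 0; first by rewrite /f eqxx subrr cabs0 mulr_ge0 ?exprn_ge0.
    have ch0 : 0 < cabs h by rewrite cabs_gt0.
    rewrite -(ler_pM2l (exprn_gt0 k ch0)) -(cabsX h k) -cabsM mulrBr -gE cabsX.
    by rewrite mulrCA -exprD gB.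
  have ct0 : 0 < cabs t by rewrite cabs_gt0.
  apply: (near_has_jet (f := fun t => t^-1 ^+ k * g t) (d := cabs t / 2)).
  - by rewrite divr_gt0.
  - move=> h hd; rewrite /f; case: eqP => // /eqP; rewrite -cabs_eq0 => /eqP th.
    by exfalso; have := cabsB_le t (- h); rewrite cabsN opprK th; lra.
  - by apply: has_jetM (gjet t t1); apply: has_jetX; exact: has_jet_inv.
have f_le t : cabs t <= 1 -> cabs (f t) <= M.
  apply: disc_maximum => // s s1; rewrite /f; case: eqP => [s0|_].
    by move/eqP: s1; rewrite s0 cabs0 eq_sym oner_eq0.
  by rewrite cabsM cabsX cabsV s1 invr1 expr1n mul1r gM.
split; first by have := f_le 0; rewrite /f eqxx cabs0 ler01; exact.
by move=> t t1; rewrite gE cabsM cabsX mulrC ler_wpM2r ?exprn_ge0 ?cabs_ge0 // f_le.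
Qed.

End Disc.

(** * Multi-indices *)

Section MultiIndex.
Context {n : nat}.
Implicit Types (K J : mindex n).

Definition box (N : nat) : seq (mindex n) :=
  [seq mindex_of K | K : {ffun 'I_n -> 'I_N}].

(** Sums over [|K| <= m] are taken along this list: unlike boxes, these sets of
    multi-indices are compatible with a shift by a unit vector, hence with
    differentiation. *)
Definition degs (m : nat) : seq (mindex n) :=
  [seq K <- box m.+1 | (mlength K <= m)%N].

Lemma le_mlength K j : (K j <= mlength K)%N.
Proof. by rewrite /mlength (bigD1 j) //= leq_addr. Qed.

Lemma mem_box N K : (K \in box N) = [forall j, K j < N]%N.
Proof.
apply/fintype.imageP/forallP => [[K' _ -> j]|K_lt]; first by rewrite ffunE.
exists [ffun j => Ordinal (K_lt j)] => //.
by apply/ffunP => j; rewrite !ffunE.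
Qed.

Lemma mindex_of_inj N : injective (@mindex_of n N).
Proof.
move=> K J KJ; apply/ffunP => j; apply: val_inj.
by have /ffunP/(_ j) := KJ; rewrite !ffunE.
Qed.

Lemma uniq_box N : uniq (box N).
Proof. by rewrite map_inj_uniq ?enum_uniq //; exact: mindex_of_inj. Qed.

Lemma mem_degs m K : (K \in degs m) = (mlength K <= m)%N.
Proof.
rewrite mem_filter mem_box; apply: andb_idr => Km; apply/forallP => j.
by rewrite ltnS (leq_trans (le_mlength K j)).
Qed.

Lemma uniq_degs m : uniq (degs m).
Proof. by rewrite filter_uniq ?uniq_box. Qed.

Lemma perm_degs_box m N : (m < N)%N -> perm_eq (degs m) [seq K <- box N | (mlength K <= m)%N].
Proof.
move=> mN; apply: uniq_perm; rewrite ?uniq_degs ?filter_uniq ?uniq_box // => K.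
rewrite mem_degs mem_filter mem_box; apply/esym/andb_idr => Km; apply/forallP => j.
by rewrite (leq_trans _ mN) // ltnS (leq_trans (le_mlength K j)).
Qed.

Lemma perm_degs_degs m N : (m <= N)%N ->
  perm_eq (degs m) [seq K <- degs N | (mlength K <= m)%N].
Proof.
move=> mN; apply: uniq_perm; rewrite ?uniq_degs ?filter_uniq ?uniq_degs ?uniq_box // => K.
by rewrite mem_degs mem_filter mem_degs; apply/esym/andb_idr => /leq_trans; exact.
Qed.

(** The sum [K + e_j]. *)
Definition mshift j K : mindex n := [ffun i => (K i + (i == j))%N].

Definition mindex0 : mindex n := [ffun=> 0%N].

Lemma mlength_mshift j K : mlength (mshift j K) = (mlength K).+1.
Proof.
rewrite /mlength; under eq_bigr do rewrite ffunE.
rewrite big_split /= (_ : \sum_(i < n) (i == j) = 1)%N ?addn1 //.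
by rewrite (bigD1 j) //= eqxx big1 // => i /negbTE ->.
Qed.

Lemma mshift_inj j : injective (mshift j).
Proof.
move=> K J KJ; apply/ffunP => i; have /ffunP/(_ i) := KJ.
by rewrite !ffunE => /addIn.
Qed.

Lemma mlength0 : mlength mindex0 = 0%N.
Proof. by rewrite /mlength big1 // => j _; rewrite ffunE. Qed.

Lemma mlength_eq0 K : mlength K = 0%N -> K = mindex0.
Proof.
move=> K0; apply/ffunP => j; rewrite ffunE; apply/eqP.
by have := le_mlength K j; rewrite K0 leqn0.
Qed.

Lemma perm_mshift j m :
  perm_eq [seq mshift j K | K <- degs m] [seq K : mindex n <- degs m.+1 | (0 < K j)%N].
Proof.
apply: uniq_perm; rewrite ?filter_uniq ?(map_inj_uniq (@mshift_inj j)) ?uniq_degs ?uniq_box //.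
move=> K; rewrite [in RHS]mem_filter mem_degs; apply/mapP/andP => [[J + ->]|[Kj Km]].
  by rewrite mem_degs mlength_mshift ltnS !ffunE eqxx addn1.
have KE : K = mshift j [ffun i => (K i - (i == j))%N].
  by apply/ffunP => i; rewrite !ffunE subnK //; case: eqP => // ->.
by eexists; last exact: KE; rewrite mem_degs -ltnS -(mlength_mshift j) -KE.
Qed.

End MultiIndex.

(** * Peano expansions of all orders *)

Section Taylor.
Context {R : realType} {n : nat}.
Implicit Types (F : 'rV[C R]_n -> C R) (c : mindex n -> C R) (a z w : 'rV[C R]_n).

Definition taylor_poly c (m : nat) w : C R := \sum_(K <- degs m) c K * cmonom w K.

(** [c] is the family of Taylor coefficients of [F] at [a], in the sense of Peano.
    The bound [s] on the coordinates of [w] plays the role of the norm of [w]; that it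
    need not be attained lets one vary the radius with [w] fixed. *)
Definition taylor F a c : Prop := forall m, exists B d : R, [/\ 0 <= B, 0 < d &
  forall (s : R) w, 0 <= s <= d -> (forall j, cabs (w ord0 j) <= s) ->
    cabs (F (a + w) - taylor_poly c m w) <= B * s ^+ m.+1].

Lemma cabs_cmonom_le w K (s : R) : (forall j, cabs (w ord0 j) <= s) ->
  cabs (cmonom w K) <= s ^+ mlength K.
Proof.
move=> ws; rewrite /cmonom cabs_prod /mlength -prodrXr.
apply: ler_prod => j _; rewrite cabs_ge0 cabsX /=.
by rewrite lerXn2r ?nnegrE ?cabs_ge0 // (le_trans (cabs_ge0 _) (ws j)).
Qed.

(** The only use of the power series: on the polydisc of radius [s = e / 2] the
    series converges absolutely, and a term of length [> m] gains a factor
    [(t / s) ^+ m.+1] when the coordinates are bounded by [t <= s]. *)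
Lemma analytic_taylor (A : set 'rV[C R]_n) F a : analytic_on A F -> A a ->
  exists c, taylor F a c.
Proof.
move=> FA /FA[c [e [e0 Fe]]]; exists c => m.
pose s := e / 2; have s0 : 0 < s by rewrite divr_gt0.
have se : s < e by rewrite /s; lra.
have [] := Fe (a + const_mx s%:C%C).
  by move=> j; rewrite !mxE addrAC subrr add0r cabs_real ger0_norm // ltW.
rewrite /summable (addrC a) addrK => sum_c _.
set S := esum _ _ in sum_c.
have S_fin : S \is a fin_num.
  rewrite ge0_fin_numE //; exact: esum_ge0.
have mono_s K : cabs (c K * cmonom (const_mx s%:C%C) K) = cabs (c K) * s ^+ mlength K.
  rewrite cabsM /cmonom cabs_prod /mlength -prodrXr; congr (_ * _).
  by apply: eq_bigr => j _; rewrite mxE cabsX cabs_real gtr0_norm.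
have le_S (A' : seq (mindex n)) : uniq A' ->
    \sum_(K <- A') cabs (c K) * s ^+ mlength K <= fine S.
  move=> uA; rewrite -lee_fin fineK //.
  apply: esum_ge; exists [set` A']; first by split; [exact: finite_seq|].
  rewrite -fsbig_seq // -sumEFin; apply: lee_sum => K _.
  by rewrite lee_fin mono_s ger0_norm // mulr_ge0 ?cabs_ge0 ?exprn_ge0 // ltW.
exists (fine S / s ^+ m.+1), s.
have S0 : 0 <= fine S by apply: fine_ge0; exact: esum_ge0.
split=> //.
  by rewrite divr_ge0 // exprn_ge0 // ltW.
move=> t w /andP[t0 ts] wt.
have [|_] := Fe (a + w).
  move=> j; rewrite !mxE addrAC subrr add0r.
  exact: le_lt_trans (le_trans (wt j) ts) se.
rewrite (addrC a) addrK => cvg_box.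
apply/ler_addgt0Pr => x x0.
move/cvgrPdist_lt: cvg_box => /(_ x%:C%C).
rewrite ltcR => /(_ x0)[N0 _ {}cvg_box].
pose N := maxn N0 m.+1.
have := cvg_box N (leq_maxl _ _); rewrite cnormE ltcR => {}cvg_box.
have boxE : \sum_(K : {ffun 'I_n -> 'I_N}) c (mindex_of K) * cmonom w (mindex_of K) =
    \sum_(K <- box N) c K * cmonom w K by rewrite big_map big_enum.
rewrite boxE in cvg_box.
have polyE : taylor_poly c m w = \sum_(K <- box N | (mlength K <= m)%N) c K * cmonom w K.
  by rewrite /taylor_poly (perm_big _ (perm_degs_box (leq_maxr N0 m.+1))) big_filter.
have -> : F (w + a) - taylor_poly c m w = (\sum_(K <- box N | (m < mlength K)%N) c K * cmonom w K)
    + (F (w + a) - \sum_(K <- box N) c K * cmonom w K).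
  rewrite (bigID (fun K => mlength K <= m)%N predT) /= -polyE.
  under [X in F _ - (_ + X)]eq_bigl do rewrite -ltnNge.
  by ring.
apply: le_trans (cabsD _ _) _; apply: lerD; last exact: ltW.
apply: le_trans (cabs_sum _ _ _) _.
have tail K : (m < mlength K)%N -> cabs (c K * cmonom w K) <=
    (cabs (c K) * s ^+ mlength K) * (t / s) ^+ m.+1.
  move=> mK; rewrite cabsM -mulrA; apply: ler_wpM2l; first exact: cabs_ge0.
  apply: le_trans (cabs_cmonom_le _ wt) _.
  have -> : t ^+ mlength K = s ^+ mlength K * (t / s) ^+ mlength K.
    by rewrite -exprMn mulrC divfK // gt_eqF.
  apply: ler_wpM2l; first by rewrite exprn_ge0 ?ltW.
  apply: ler_wiXn2l => //; first by rewrite divr_ge0 ?(ltW s0).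
  by rewrite ler_pdivrMr // mul1r.
apply: le_trans (ler_sum _ tail) _.
rewrite -mulr_suml mulrAC -mulrA -expr_div_n; apply: ler_wpM2r.
  by rewrite exprn_ge0 // divr_ge0 // ltW.
by rewrite -big_filter; apply: le_S; rewrite filter_uniq ?uniq_box.
Qed.

End Taylor.

(** * Restriction to complex lines *)

Section TaylorCalculus.
Context {R : realType} {n : nat}.
Implicit Types (F : 'rV[C R]_n -> C R) (c : mindex n -> C R) (a z w v : 'rV[C R]_n).

(** The Taylor polynomial of [h |-> F (a + h *: v)]. *)
Definition line_poly c m v : {poly C R} :=
  \sum_(K <- degs m) (c K * cmonom v K)%:P * 'X^(mlength K).

Lemma cmonomZ (h : C R) v K : cmonom (h *: v) K = h ^+ mlength K * cmonom v K.
Proof.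
rewrite /cmonom /mlength -prodrXr -big_split /=.
by apply: eq_bigr => j _; rewrite mxE exprMn.
Qed.

Lemma horner_line_poly c m v h : (line_poly c m v).[h] = taylor_poly c m (h *: v).
Proof.
rewrite /line_poly /taylor_poly horner_sum; apply: eq_bigr => K _.
by rewrite hornerM hornerC hornerXn cmonomZ mulrA mulrAC.
Qed.

Lemma rV_bounded v : exists2 V : R, 0 < V & forall j, cabs (v ord0 j) <= V.
Proof.
exists (1 + \sum_j cabs (v ord0 j)).
  by apply: ltr_pwDl => //; apply: sumr_ge0 => j _; exact: cabs_ge0.
move=> j; rewrite (bigD1 j) //= addrCA lerDl addr_ge0 // sumr_ge0 // => i _.
exact: cabs_ge0.
Qed.

Lemma taylor_line F a c m v : taylor F a c -> exists B d : R, [/\ 0 <= B, 0 < d &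
  forall h, cabs h <= d ->
    cabs (F (a + h *: v) - (line_poly c m v).[h]) <= B * cabs h ^+ m.+1].
Proof.
move=> /(_ m)[B [d [B0 d0 Fd]]]; have [V V0 vV] := rV_bounded v.
exists (B * V ^+ m.+1), (d / V); split; first by rewrite mulr_ge0 // exprn_ge0 // ltW.
  by rewrite divr_gt0.
move=> h; rewrite ler_pdivlMr // => hd; rewrite horner_line_poly -mulrA -exprMn mulrC.
rewrite (mulrC V) [leRHS]mulrC; apply: Fd => [|j].
  by rewrite hd mulr_ge0 ?cabs_ge0 // ltW.
by rewrite mxE cabsM ler_wpM2l ?cabs_ge0.
Qed.

Lemma taylor_has_jet F a c v : taylor F a c -> has_jet (fun h => F (a + h *: v)) 0.
Proof.
move=> Fa; have [B [d [_ d0 Fd]]] := taylor_line 2 v Fa.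
by exists (line_poly c 2 v), B, d; split=> // h hd; rewrite add0r Fd.
Qed.

Lemma taylor_has_jet_at F a v t c : taylor F (a + t *: v) c ->
  has_jet (fun h => F (a + h *: v)) t.
Proof.
move=> /(taylor_has_jet v)[p [B [d [d0 Fd]]]]; exists p, B, d; split=> // h hd.
by have := Fd h hd; rewrite add0r scalerDl addrA.
Qed.

Lemma taylor_poly0 c m : taylor_poly c m 0 = c mindex0.
Proof.
rewrite /taylor_poly (bigD1_seq mindex0) ?uniq_degs //=; last by rewrite mem_degs mlength0.
rewrite big1_seq ?addr0 => [|K /andP[K0 _]].
  by rewrite /cmonom big1 ?mulr1 // => j _; rewrite ffunE expr0.
have [j Kj] : exists j, K j != 0%N.
  apply/existsP; apply: contraR K0 => /existsPn K0.
  by apply/eqP/ffunP => j; rewrite ffunE; apply/eqP; have := K0 j; rewrite negbK.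
by rewrite /cmonom (bigD1 j) //= mxE expr0n (negbTE Kj) mul0r mulr0.
Qed.

Lemma taylor_value F a c : taylor F a c -> c mindex0 = F a.
Proof.
move=> /(_ 0%N)[B [d [B0 d0]]] /(_ 0 0); rewrite lexx (ltW d0) addr0 taylor_poly0.
rewrite expr1 mulr0 => /(_ isT) H; apply/esym/eqP; rewrite -subr_eq0 -cabs_eq0.
by rewrite eq_le cabs_ge0 andbT H // => j; rewrite mxE cabs0.
Qed.

Lemma taylor_cts F a c : taylor F a c -> cts F a.
Proof.
move=> Fa e e0; have c0 := taylor_value Fa.
have [B [d [B0 d0 Fd]]] := Fa 0%N.
exists (Num.min d (e / (1 + B))) => [|z zd].
  by rewrite lt_min d0 divr_gt0 //; lra.
set s := Num.min _ _ in zd.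
have s0 : 0 < s by rewrite lt_min d0 divr_gt0 //; lra.
have sd : s <= d by rewrite /s ge_min lexx.
have se : s * (1 + B) <= e by rewrite -ler_pdivlMr; [rewrite /s ge_min lexx orbT|lra].
have := Fd s (z - a); rewrite (ltW s0) sd => /(_ isT).
rewrite (addrC a) subrK expr1 => {}Fd.
have poly0 w : taylor_poly c 0 w = F a.
  rewrite -c0 /taylor_poly -(taylor_poly0 c 0); apply: eq_big_seq => K.
  rewrite mem_degs leqn0 => /eqP/mlength_eq0 ->; congr (_ * _).
  by rewrite /cmonom; apply: eq_bigr => j _; rewrite ffunE !expr0.
rewrite -(poly0 (z - a)); apply: le_lt_trans (Fd _) _ => [j|].
  by rewrite !mxE; apply: ltW.
by apply: lt_le_trans se; lra.
Qed.

Lemma derive_line F z v (p : {poly C R}) :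
  (exists B d : R, 0 < d /\
    forall h, cabs h <= d -> cabs (F (z + h *: v) - p.[h]) <= B * cabs h ^+ 2) ->
  'D_v F z = p`_1.
Proof.
move=> [B [d [d0 Fp]]].
have p0 : p`_0 = F z.
  have := Fp 0; rewrite cabs0 (ltW d0) expr0n mulr0 scale0r addr0 => /(_ isT).
  by rewrite le_eqVlt ltNge cabs_ge0 orbF cabs_eq0 subr_eq0 => /eqP ->; rewrite horner_coef0.
have [Q Q0 pQ] := horner_bounded (drop_poly 2 p).
pose S := `|B| + Q; have S0 : 0 <= S by rewrite addr_ge0.
apply: (@cvg_lim (C R)); first exact: norm_hausdorff.
apply/cvgrPdist_lt => e; rewrite ltcE /= => /andP[/eqP e_im e0].
have -> : e = (complex.Re e)%:C%C by case: e e_im {e0} => x y /= ->.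
set x := complex.Re e in e0 *.
apply: (@nbhs_cabs _ _ _ (Num.min (Num.min d 1) (x / (1 + S)))).
  by rewrite !lt_min d0 ltr01 divr_gt0 //; lra.
move=> h; rewrite subr0 !lt_min => /andP[/andP[hd h1]].
rewrite ltr_pdivlMr => [hx h0|]; last lra.
rewrite cnormE ltcR /= (addrC _ z).
have ch0 : 0 < cabs h by rewrite cabs_gt0.
rewrite -(ltr_pM2l ch0) -cabsM.
have -> : h * (p`_1 - h^-1 *: (F (z + h *: v) - F z)) =
    - ((F (z + h *: v) - p.[h]) + (drop_poly 2 p).[h] * h ^+ 2).
  rewrite -[in RHS](poly_take_drop 2 p) hornerD hornerM hornerXn.
  rewrite (horner_coef_wide _ (size_take_poly 2 p)) drop_polyDMXn ?size_take_poly //.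
  rewrite -p0 !big_ord_recl big_ord0 !coef_take_poly /= mulrBr mulrA mulfV // mul1r.
  by ring.
rewrite cabsN; apply: le_lt_trans (cabsD _ _) _; rewrite cabsM cabsX.
have := Fp h (ltW hd); have := ler_wpM2r (sqr_ge0 (cabs h)) (pQ h (ltW h1)).
have := ler_wpM2r (sqr_ge0 (cabs h)) (ler_norm B).
have : cabs h * (cabs h * (1 + S)) < cabs h * x by rewrite ltr_pM2l.
have : 0 < cabs h ^+ 2 by rewrite exprn_gt0.
rewrite /S !expr2; lra.
Qed.

End TaylorCalculus.

(** * Differentiation of Peano expansions *)

Section TaylorDerivative.
Context {R : realType} {n : nat}.
Implicit Types (F : 'rV[C R]_n -> C R) (c : mindex n -> C R) (a z w v : 'rV[C R]_n).

(** Schwarz' lemma for [g (rho * t) - g 0], which vanishes at [0]. The factor [2] is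
    the price of subtracting [g 0]. The expansion of order [4] at [0] leaves one of
    order [3] after division by the variable. *)
Lemma cauchy_first (g : C R -> C R) (p : {poly C R}) (rho M : R) : 0 < rho ->
  (forall t, cabs t <= rho -> has_jet g t) ->
  (exists B d : R, 0 < d /\
     forall h, cabs h <= d -> cabs (g h - p.[h]) <= B * cabs h ^+ 4) ->
  (forall t, cabs t <= rho -> cabs (g t) <= M) ->
  cabs p`_1 * rho <= 2 * M.
Proof.
move=> rho0 gjet [B [d [d0 gp]]] gM.
have crho : cabs (rho%:C%C : C R) = rho by rewrite cabs_real gtr0_norm.
have g0 : g 0 = p`_0.
  have := gp 0; rewrite cabs0 (ltW d0) [in leRHS]expr0n mulr0 => /(_ isT).
  by rewrite le_eqVlt ltNge cabs_ge0 orbF cabs_eq0 subr_eq0 horner_coef0 => /eqP.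
pose q := (rho%:C%C)%:P * (drop_poly 1 p \Po ((rho%:C%C)%:P * 'X)).
have qE (h : C R) : q.[h] = rho%:C%C * (drop_poly 1 p).[rho%:C%C * h].
  by rewrite /q hornerM hornerC horner_comp hornerM hornerC hornerX.
have q0 : q.[0] = p`_1 * rho%:C%C by rewrite qE mulr0 horner_coef0 coef_drop_poly mulrC.
have sM t : cabs t <= 1 -> cabs (rho%:C%C * t) <= rho.
  by move=> t1; rewrite cabsM crho ler_piMr // ltW.
have [] := @schwarz _ (fun t => g (rho%:C%C * t) - g 0) 1 q (2 * M).
- move=> t t1; apply: has_jetD; last first.
    by apply: eq_has_jet (has_jet_poly (- g 0)%:P t) => x; rewrite hornerC.
  by apply: eq_has_jet (has_jetZ (a := rho%:C%C) 1 (gjet _ (sM t t1))) => x; rewrite mul1r.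
- exists (B * rho ^+ 4), (d / rho); split=> [|h]; first by rewrite divr_gt0.
  rewrite ler_pdivlMr // => hd; rewrite qE g0 expr1 -[4%N]/(1 + 3)%N.
  have -> : g (rho%:C%C * h) - p`_0 - h * (rho%:C%C * (drop_poly 1 p).[rho%:C%C * h]) =
      g (rho%:C%C * h) - p.[rho%:C%C * h].
    rewrite -[in RHS](poly_take_drop 1 p) hornerD hornerM hornerXn.
    rewrite (horner_coef_wide _ (size_take_poly 1 p)).
    by rewrite !big_ord_recl big_ord0 !coef_take_poly /=; ring.
  have rhE : cabs (rho%:C%C * h) = rho * cabs h by rewrite cabsM crho.
  rewrite -mulrA -exprMn -rhE; apply: gp.
  by rewrite cabsM crho mulrC.
- move=> t t1; apply: le_trans (cabsD _ _) _; rewrite cabsN mulr_natl mulr2n.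
  by apply: lerD; apply: gM; [apply: sM; rewrite t1|rewrite cabs0 ltW].
by rewrite q0 cabsM crho.
Qed.

(** Formal differentiation in the [j]-th variable, on coefficients. *)
Definition dcoef (j : 'I_n) c : mindex n -> C R :=
  fun K => (K j).+1%:R * c (mshift j K).

(** The Taylor polynomial restricted to the line through [w] in the direction of the
    [j]-th variable; unlike [line_poly], the base point is not the centre. *)
Definition slice_poly c m w (j : 'I_n) : {poly C R} :=
  \sum_(K <- degs m) (c K * \prod_(i | i != j) w ord0 i ^+ K i)%:P *
    ('X + (w ord0 j)%:P) ^+ K j.

Lemma horner_slice_poly c m w j h :
  (slice_poly c m w j).[h] = taylor_poly c m (w + h *: delta_mx ord0 j).
Proof.
rewrite /slice_poly /taylor_poly horner_sum; apply: eq_bigr => K _.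
rewrite hornerM hornerC horner_exp hornerD hornerX hornerC -mulrA; congr (_ * _).
rewrite /cmonom [RHS](bigD1 j) //= mulrC !mxE !eqxx mulr1 (addrC h); congr (_ * _).
by apply: eq_bigr => i /negbTE ij; rewrite !mxE ij andbF mulr0 addr0.
Qed.

Lemma coef1_slice_poly c m w j :
  (slice_poly c m.+1 w j)`_1 = taylor_poly (dcoef j c) m w.
Proof.
have -> (p : {poly C R}) : p`_1 = p^`().[0] by rewrite horner_coef0 coef_deriv mulr1n.
rewrite /slice_poly (raddf_sum (@deriv (C R))) horner_sum.
have termE (K : mindex n) : ((c K * \prod_(i | i != j) w ord0 i ^+ K i)%:P *
    ('X + (w ord0 j)%:P) ^+ K j)^`().[0] =
    (c K * \prod_(i | i != j) w ord0 i ^+ K i) * (w ord0 j ^+ (K j).-1 *+ K j).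
  rewrite derivM derivC mul0r add0r deriv_exp derivD derivX derivC addr0 mul1r.
  by rewrite hornerM hornerC hornerMn horner_exp hornerD hornerX hornerC add0r.
under eq_bigr do rewrite termE.
rewrite (bigID (fun K : mindex n => 0 < K j)%N) /= addrC big1 ?add0r; last first.
  by move=> K; rewrite lt0n negbK => /eqP ->; rewrite mulr0n mulr0.
rewrite -big_filter -(perm_big _ (perm_mshift j m)) big_map.
apply: eq_bigr => K _; rewrite /dcoef !ffunE eqxx addn1 /= -mulr_natl.
rewrite /cmonom [in RHS](bigD1 j) //=.
under eq_bigr => i /negbTE ij do rewrite ffunE ij addn0.
by ring.
Qed.

Lemma taylor_derive F z c j : taylor F z c ->
  'D_(delta_mx ord0 j) F z = (line_poly c 3 (delta_mx ord0 j))`_1.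
Proof.
move=> Fz; apply: derive_line; have [B [d [B0 d0 Fd]]] := taylor_line 3 (delta_mx ord0 j) Fz.
exists B, (Num.min d 1); split=> [|h]; first by rewrite lt_min d0 ltr01.
rewrite le_min => /andP[hd h1]; apply: le_trans (Fd h hd) _.
by rewrite ler_wpM2l // ler_wiXn2l // cabs_ge0.
Qed.

Lemma le0_of_small (x B d : R) : 0 < d -> (forall e : R, 0 < e <= d -> x <= B * e) -> x <= 0.
Proof.
move=> d0 H; rewrite leNgt; apply/negP => x0.
pose e := Num.min d (x / (2 * (1 + `|B|))).
have B1 : 0 < 2 * (1 + `|B|) by rewrite mulr_gt0 // ltr_pwDl.
have e0 : 0 < e by rewrite lt_min d0 divr_gt0.
have ex : e * (2 * (1 + `|B|)) <= x by rewrite -ler_pdivlMr // /e ge_min lexx orbT.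
have := H e; rewrite e0 /e ge_min lexx => /(_ isT); rewrite -/e => xB.
have := ler_wpM2r (ltW e0) (ler_norm B); lra.
Qed.

(** Peano expansions cannot be differentiated in general; here the existence of
    expansions at all nearby points makes [F] holomorphic. The remainder of order
    [m + 1] of [F] is [O(rho ^ (m + 2))] on the polydisc of radius [2 rho], hence by
    Cauchy's estimate on discs of radius [rho] its derivative is
    [O(rho ^ (m + 1))]. *)
Lemma taylor_dcoef F a c j (d0 : R) : 0 < d0 ->
  (forall w, (forall i, cabs (w ord0 i) <= d0) -> exists c', taylor F (a + w) c') ->
  taylor F a c -> taylor ('D_(delta_mx ord0 j) F) a (dcoef j c).
Proof.
move=> d00 Fnear Fa m; have [B [d [B0 dgt0 Fd]]] := Fa m.+1.
pose d' := Num.min d d0 / 2.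
have d'0 : 0 < d' by rewrite divr_gt0 // lt_min dgt0.
have le_d : 2 * d' <= d by rewrite /d' mulrC divfK // ge_min lexx.
have le_d0 : 2 * d' <= d0 by rewrite /d' mulrC divfK // ge_min lexx orbT.
have B2 : 0 <= 2 * B * 2 ^+ m.+2 by rewrite mulr_ge0 ?exprn_ge0 // mulr_ge0.
exists (2 * B * 2 ^+ m.+2), d'; split=> //.
move=> s w /andP[s0 sd'] ws.
have main rho : 0 < rho -> s <= rho -> rho <= d' ->
    cabs ('D_(delta_mx ord0 j) F (a + w) - taylor_poly (dcoef j c) m w) <=
    2 * B * 2 ^+ m.+2 * rho ^+ m.+1.
  move=> rho0 s_rho rho_d'.
  have in2 t : cabs t <= rho -> forall i, cabs ((w + t *: delta_mx ord0 j) ord0 i) <= 2 * rho.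
    move=> t_rho i; rewrite !mxE; apply: le_trans (cabsD _ _) _.
    rewrite mulr_natl mulr2n; apply: lerD; first exact: le_trans (ws i) s_rho.
    by apply: le_trans t_rho; case: (_ && _); rewrite ?mulr1 // mulr0 cabs0 cabs_ge0.
  have rho2 : 0 <= 2 * rho by rewrite mulr_ge0 // ltW.
  have [c' Fz] : exists c', taylor F (a + w) c'.
    by apply: Fnear => i; apply: le_trans (ws i) _; lra.
  pose g t := F (a + w + t *: delta_mx ord0 j) - (slice_poly c m.+1 w j).[t].
  rewrite (taylor_derive j Fz) -coef1_slice_poly -coefB -(ler_pM2r rho0).
  apply: (@le_trans _ _ (2 * (B * (2 * rho) ^+ m.+2))).
    apply: (@cauchy_first g) => // [t t_rho||t t_rho].
    - apply: has_jetD; last first.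
        by apply: eq_has_jet (has_jet_poly (- slice_poly c m.+1 w j) t) => x; rewrite hornerN.
      have [c'' Ft] : exists c'', taylor F (a + w + t *: delta_mx ord0 j) c''.
        by rewrite -addrA; apply: Fnear => i; apply: le_trans (in2 t t_rho i) _; lra.
      exact: taylor_has_jet_at Ft.
    - have [B' [e [_ e0 Fe]]] := taylor_line 3 (delta_mx ord0 j) Fz.
      exists B', e; split=> // h he; rewrite /g hornerD hornerN opprB addrA addrAC.
      by rewrite [X in cabs X](_ : _ = F (a + w + h *: delta_mx ord0 j) -
        (line_poly c' 3 (delta_mx ord0 j)).[h]) ?Fe //; ring.
    - rewrite /g horner_slice_poly -addrA; apply: Fd (in2 t t_rho).
      by rewrite rho2 /=; lra.
  by rewrite exprMn (exprS rho m.+1) le_eqVlt; apply/orP; left; apply/eqP; ring.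
(* for s = 0 there is no disc of radius s; let rho tend to 0 instead *)
have [s_eq0|s_neq0] := eqVneq s 0; last by apply: main => //; rewrite lt_def s_neq0.
rewrite s_eq0 expr0n mulr0.
apply: (@le0_of_small _ (2 * B * 2 ^+ m.+2) (Num.min d' 1)); first by rewrite lt_min d'0 ltr01.
move=> e /andP[e0]; rewrite le_min => /andP[ed' e1].
apply: le_trans (main e e0 _ ed') _; first by rewrite s_eq0 ltW.
apply: ler_wpM2l => //.
by rewrite exprS ler_piMr ?(ltW e0) // exprn_ile1 // ltW.
Qed.

Definition taylor_on (U : set 'rV[C R]_n) F (c : 'rV[C R]_n -> mindex n -> C R) : Prop :=
  forall a, U a -> taylor F a (c a).

(** Weighting coefficients by factorials turns differentiation into a shift. *)
Lemma dcoefE j c K : (mfact K)%:R * dcoef j c K = (mfact (mshift j K))%:R * c (mshift j K).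
Proof.
rewrite /dcoef mulrA -natrM; congr (_%:R * _).
rewrite /mfact (bigD1 j) //= [RHS](bigD1 j) //= !ffunE eqxx addn1 factS.
under [in RHS]eq_bigr => i /negbTE ij do rewrite ffunE ij addn0.
by rewrite mulnC mulnA.
Qed.

Lemma iter_dcoefE j k c K : (mfact K)%:R * iter k (dcoef j) c K =
  (mfact (iter k (mshift j) K))%:R * c (iter k (mshift j) K).
Proof.
elim: k K => // k IH K.
by rewrite iterS dcoefE IH -iterSr.
Qed.

Lemma iter_mshift j k (K : mindex n) i : iter k (mshift j) K i = (K i + (i == j) * k)%N.
Proof.
elim: k => [|k IH]; first by rewrite muln0 addn0.
by rewrite iterS ffunE IH mulnS -addnA (addnC (i == j)).
Qed.

Lemma foldr_dcoefE (s : seq 'I_n) (K : mindex n) c (J : mindex n) : uniq s ->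
  let J' : mindex n := [ffun i => (J i + (i \in s) * K i)%N] in
  (mfact J)%:R * foldr (fun j c => iter (K j) (dcoef j) c) c s J = (mfact J')%:R * c J'.
Proof.
elim: s J => [|j s IH] J /=.
  by move=> _; rewrite (_ : finfun _ = J) //; apply/ffunP => i; rewrite ffunE addn0.
move=> /andP[js us]; rewrite iter_dcoefE IH //; congr ((mfact _)%:R * c _);
  apply/ffunP => i; rewrite !ffunE iter_mshift in_cons;
  by case: eqP => [->|_]; rewrite ?(negbTE js) ?mul0n ?mul1n ?addn0.
Qed.

(** After iterated differentiation the constant coefficient, which is the value of
    [mderive F K] at [a], is [K!] times the coefficient of index [K] of [F]. *)
Lemma mderive_taylor (U : set 'rV[C R]_n) F (c : 'rV[C R]_n -> mindex n -> C R) :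
  (forall a, U a -> exists2 d : R, 0 < d &
     forall w, (forall i, cabs (w ord0 i) <= d) -> U (a + w)) ->
  taylor_on U F c -> forall a K, U a -> mderive F K a = (mfact K)%:R * c a K.
Proof.
move=> Uopen Fc a K Ua.
have step G b j : taylor_on U G b ->
    taylor_on U ('D_(delta_mx ord0 j) G) (fun z => dcoef j (b z)).
  move=> Gb z Uz; have [d d0 Ud] := Uopen z Uz.
  have Gnear w : (forall i, cabs (w ord0 i) <= d) -> exists c', taylor G (z + w) c'.
    by move=> wd; exists (b (z + w)); apply: Gb; exact: Ud.
  exact: (taylor_dcoef j d0 Gnear (Gb z Uz)).
have steps k G b j : taylor_on U G b ->
    taylor_on U (iter k (fun H => 'D_(delta_mx ord0 j) H) G) (fun z => iter k (dcoef j) (b z)).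
  by move=> Gb; elim: k => //= k IH; exact: step.
have all_steps : taylor_on U (mderive F K)
    (fun z => foldr (fun j b => iter (K j) (dcoef j) b) (c z) (enum 'I_n)).
  by rewrite /mderive; elim: (enum 'I_n) => //= j s IH; exact: steps.
rewrite -(taylor_value (all_steps a Ua)).
have := foldr_dcoefE K (c a) mindex0 (enum_uniq 'I_n).
have -> : mfact (mindex0 : mindex n) = 1%N by rewrite /mfact big1 // => i _; rewrite ffunE.
rewrite mul1r => ->; congr ((mfact _)%:R * c a _);
  by apply/ffunP => i; rewrite !ffunE mem_enum mul1n.
Qed.

End TaylorDerivative.

(** * Cauchy's estimates and the Taylor remainder on a polydisc *)

Section CauchyEstimates.
Context {R : realType} {n : nat}.
Implicit Types (F : 'rV[C R]_n -> C R) (c : mindex n -> C R) (a z w v : 'rV[C R]_n).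

Lemma prim_root_exists (N : nat) : (0 < N)%N -> exists x : C R, N.-primitive_root x.
Proof.
move=> N0; pose p : {poly R[i]} := 'X^N - 1.
have [s ps] := closed_field_poly_normal p.
have lp : lead_coef p = 1 by rewrite lead_coefDl ?lead_coefXn // size_polyXn size_polyN size_poly1.
have sp : size p = N.+1 by rewrite size_polyDl size_polyXn // size_polyN size_poly1.
rewrite lp scale1r in ps.
have size_s : size s = N by apply/eqP; rewrite -eqSS -sp ps size_prod_XsubC.
have root_s : all N.-unity_root s.
  by apply/allP => x xs; rewrite /root_of_unity -/p ps root_prod_XsubC.
have uniq_s : uniq s.
  have : separable_poly p by rewrite separable_Xn_sub_1 // pnatr_eq0 -lt0n.
  by rewrite ps separable_prod_XsubC.
have /hasP[x _ xN] := has_prim_root N0 root_s uniq_s (eq_leq (esym size_s)).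
by exists x.
Qed.

Lemma cabs_prim_root N (x : C R) : N.-primitive_root x -> cabs x = 1.
Proof.
move=> xN; have N0 := prim_order_gt0 xN.
have : cabs x ^+ N = 1 by rewrite -cabsX prim_expr_order // cabs1.
by move/eqP; rewrite pexpr_eq1 ?cabs_ge0 // => /eqP.
Qed.

Lemma root_sum N (x : C R) (i j : nat) : N.-primitive_root x -> (i < N)%N -> (j < N)%N ->
  \sum_(k < N) (x ^+ k) ^+ i / (x ^+ k) ^+ j = if i == j then N%:R else 0.
Proof.
move=> xN iN jN; have x0 : x != 0 by rewrite -cabs_gt0 (cabs_prim_root xN).
pose y := x ^+ i / x ^+ j.
under eq_bigr => k _ do rewrite -!exprM !(mulnC k) !exprM -exprVn -exprMn -/y.
case: eqP => [ij|/eqP ij].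
  rewrite /y ij mulfV ?expf_neq0 //.
  by under eq_bigr do rewrite expr1n; rewrite sumr_const card_ord.
have y1 : y != 1.
  rewrite /y -(inj_eq (mulIf (expf_neq0 j x0))) mul1r divfK ?expf_neq0 //.
  by rewrite (eq_prim_root_expr xN) !modn_small.
apply/eqP; have /mulfI/inj_eq <- : y - 1 != 0 by rewrite subr_eq0.
rewrite mulr0 -subrX1 /y expr_div_n -!exprM !(mulnC _ N) !exprM (prim_expr_order xN).
by rewrite !expr1n divr1 subrr.
Qed.

(** The points of the torus of multiradius [r] whose arguments are multiples of
    [2 pi / N], when [x] is a primitive [N]-th root of unity. *)
Definition twist (x : C R) N (r : 'rV[R]_n) (i : {ffun 'I_n -> 'I_N}) : 'rV[C R]_n :=
  \row_j (x ^+ i j * (r ord0 j)%:C%C).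

(** The character by which one averages over these points to extract the
    coefficient of index [K]. *)
Definition twist_weight (x : C R) N (K : mindex n) (i : {ffun 'I_n -> 'I_N}) : C R :=
  \prod_j ((x ^+ i j) ^+ K j)^-1.

Lemma orthogonality (x : C R) N (r : 'rV[R]_n) (J K : mindex n) :
  N.-primitive_root x -> (forall j, J j < N)%N -> (forall j, K j < N)%N ->
  \sum_(i : {ffun 'I_n -> 'I_N}) twist_weight x K i * cmonom (twist x r i) J =
  if J == K then (N ^ n)%:R * (rmonom r K)%:C%C else 0.
Proof.
move=> xN JN KN.
have termE i : twist_weight x K i * cmonom (twist x r i) J = (rmonom r J)%:C%C *
    \prod_j ((x ^+ i j) ^+ J j / (x ^+ i j) ^+ K j).
  rewrite /twist_weight /cmonom /rmonom rmorph_prod -!big_split /=.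
  by apply: eq_bigr => j _; rewrite mxE exprMn rmorphXn /=; ring.
under eq_bigr do rewrite termE.
rewrite -mulr_sumr -(bigA_distr_bigA (fun j (k : 'I_N) => (x ^+ k) ^+ J j / (x ^+ k) ^+ K j)) /=.
under eq_bigr do rewrite (root_sum xN (JN _) (KN _)).
case: eqP => [->|JK].
  under eq_bigr do rewrite eqxx.
  by rewrite prodr_const card_ord natrX mulrC.
have [j /negbTE Jj] : exists j, J j != K j.
  apply/existsP; apply: contra_notT JK => /existsPn JK; apply/ffunP => j.
  by apply/eqP; have := JK j; rewrite negbK.
by rewrite (bigD1 j) //= Jj mul0r mulr0.
Qed.

Lemma has_jet_sum (I : Type) (s : seq I) (f : I -> C R -> C R) t :
  (forall i, has_jet (f i) t) -> has_jet (fun x => \sum_(i <- s) f i x) t.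
Proof.
move=> fj; elim: s => [|i s IH].
  by apply: eq_has_jet (has_jet_poly 0 t) => x; rewrite big_nil horner0.
by apply: eq_has_jet (has_jetD (fj i) IH) => x; rewrite big_cons.
Qed.

(** The weighted sum [g t] of [F] over the points [a + t v], [v] a rotation of [r] by
    [N]-th roots of unity, equals [N ^ n * c K * r ^ K * t ^ |K|] up to
    [O(t ^ (|K| + 3))], as soon as [N > |K| + 2]: all other monomials of length at
    most [|K| + 2] average to [0]. On the unit circle [|g| <= N ^ n * M], so Schwarz'
    lemma bounds the leading coefficient. *)
Lemma cauchy_estimate F a (r : 'rV[R]_n) c (M : R) K :
  (forall j, 0 <= r ord0 j) ->
  (forall z, polydisc a r z -> exists c', taylor F z c') ->
  taylor F a c -> (forall z, torus a r z -> cabs (F z) <= M) ->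
  cabs (c K) * rmonom r K <= M.
Proof.
move=> r0 Fjet Fa FM; pose m := (mlength K).+2; pose N := m.+1.
have [x xN] := prim_root_exists (ltn0Sn m); rewrite -/N in xN.
have x1 := cabs_prim_root xN.
have ctwist i j : cabs (twist x r i ord0 j : C R) = r ord0 j.
  by rewrite mxE cabsM cabsX x1 expr1n mul1r cabs_real ger0_norm.
have cweight i : cabs (twist_weight x K i : C R) = 1.
  by rewrite /twist_weight cabs_prod big1 // => j _; rewrite cabsV !cabsX x1 !expr1n invr1.
pose g t := \sum_(i : {ffun 'I_n -> 'I_N}) twist_weight x K i * F (a + t *: twist x r i).
have Nn : #|{ffun 'I_n -> 'I_N}| = (N ^ n)%N by rewrite card_ffun !card_ord.
pose L : C R := (N ^ n)%:R * (c K * (rmonom r K)%:C%C).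
have KN j : (K j < N)%N.
  by rewrite /N /m; apply: leq_ltn_trans (le_mlength K j) _; rewrite ltnS leqW.
have polyE t : \sum_(i : {ffun 'I_n -> 'I_N})
    twist_weight x K i * taylor_poly c m (t *: twist x r i) = t ^+ mlength K * L.
  under eq_bigr do rewrite mulr_sumr; rewrite exchange_big /=.
  have termE (J : mindex n) : J \in degs m ->
      \sum_(i : {ffun 'I_n -> 'I_N}) twist_weight x K i * (c J * cmonom (t *: twist x r i) J) =
      if J == K then t ^+ mlength K * L else 0.
    rewrite mem_degs => Jm.
    transitivity (c J * t ^+ mlength J *
        \sum_(i : {ffun 'I_n -> 'I_N}) twist_weight x K i * cmonom (twist x r i) J).
      by rewrite mulr_sumr; apply: eq_bigr => i _; rewrite cmonomZ; ring.
    rewrite orthogonality // => [|j]; last by rewrite ltnS (leq_trans (le_mlength J j)).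
    by case: eqP => [->|_]; rewrite ?mulr0 // /L; ring.
  rewrite (eq_big_seq _ termE) (bigD1_seq K) ?uniq_degs //= ?eqxx; last first.
    by rewrite mem_degs /m leqW.
  by rewrite big1 ?addr0 // => J /negbTE ->.
have [B [d [B0 d0 Fd]]] := Fa m.
pose V := 1 + \sum_j r ord0 j.
have V0 : 0 < V by rewrite ltr_pwDl // sumr_ge0.
have rV j : r ord0 j <= V.
  by rewrite /V (bigD1 j) //= addrCA lerDl addr_ge0 // sumr_ge0.
have N0 : 0 < (N ^ n)%:R :> R by rewrite ltr0n expn_gt0.
have [] := @schwarz _ g (mlength K) L%:P ((N ^ n)%:R * M).
- move=> t t1; apply: has_jet_sum => i.
  have [c' Ft] : exists c', taylor F (a + t *: twist x r i) c'.
    apply: Fjet => j; rewrite mxE addrAC subrr add0r mxE cabsM ctwist.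
    by rewrite ler_piMl.
  apply: eq_has_jet (has_jetM (has_jet_poly (twist_weight x K i)%:P t) (taylor_has_jet_at Ft)) => y.
  by rewrite hornerC.
- exists ((N ^ n)%:R * (B * V ^+ m.+1)), (d / V); split=> [|h]; first by rewrite divr_gt0.
  rewrite ler_pdivlMr // => hd; rewrite hornerC -polyE -sumrB.
  apply: le_trans (cabs_sum _ _ _) _; rewrite -Nn -mulrA mulr_natl.
  rewrite -sumr_const; apply: ler_sum => i _.
  rewrite -mulrBr cabsM cweight mul1r addn3 -mulrA -exprMn.
  apply: Fd => [|j]; first by rewrite mulr_ge0 ?cabs_ge0 ?(ltW V0) // mulrC.
  by rewrite mxE cabsM ctwist mulrC ler_wpM2r ?cabs_ge0.
- move=> t t1; apply: le_trans (cabs_sum _ _ _) _.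
  rewrite -Nn mulr_natl -sumr_const; apply: ler_sum => i _.
  rewrite cabsM cweight mul1r; apply: FM => j.
  by rewrite mxE addrAC subrr add0r mxE cabsM ctwist t1 mul1r.
rewrite hornerC /L cabsM cabs_nat cabsM cabs_real => + _.
rewrite ler_pM2l // ger0_norm // /rmonom prodr_ge0 // => j _; exact: exprn_ge0.
Qed.

(** Enlarge the range of summation to a box, where the sum is a product. *)
Lemma sum_degs_le (q : R) m : 0 < q < 1 ->
  \sum_(K <- degs m) q ^+ mlength (K : mindex n) <= (1 - q)^-1 ^+ n.
Proof.
move=> /andP[q0 q1].
rewrite /degs big_filter; apply: (@le_trans _ _ (\sum_(K <- box m.+1) q ^+ mlength (K : mindex n))).
  rewrite [leRHS](bigID (fun K => mlength K <= m)%N) /= lerDl.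
  by apply: sumr_ge0 => K _; rewrite exprn_ge0 // ltW.
rewrite big_map big_enum /=.
have termE (f : {ffun 'I_n -> 'I_m.+1}) :
    q ^+ mlength (mindex_of f) = \prod_j q ^+ (f j : nat).
  by rewrite /mlength -prodrXr; apply: eq_bigr => j _; rewrite ffunE.
under eq_bigr do rewrite termE.
rewrite -(bigA_distr_bigA (fun j (k : 'I_m.+1) => q ^+ k)) /=.
rewrite prodr_const card_ord lerXn2r ?nnegrE ?sumr_ge0 // => [i _||].
- by rewrite exprn_ge0 // ltW.
- by rewrite invr_ge0 subr_ge0 ltW.
rewrite -[leRHS]mul1r ler_pdivlMr ?subr_gt0 // mulrC -opprB mulNr -subrX1 opprB.
by rewrite gerBl exprn_ge0 // ltW.
Qed.

(** Taylor remainder on a smaller polydisc: Schwarz' lemma along the complex line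
    through the centre and the given point, where the remainder of order [m] has
    a zero of order [m + 1]. *)
Lemma taylor_remainder F a (r : 'rV[R]_n) c (M q : R) m w :
  (forall j, 0 <= r ord0 j) ->
  (forall z, polydisc a r z -> exists c', taylor F z c') ->
  taylor F a c -> (forall z, torus a r z -> cabs (F z) <= M) ->
  0 < q < 1 -> (forall j, cabs (w ord0 j) <= q ^+ 2 * r ord0 j) ->
  cabs (F (a + w) - taylor_poly c m w) <= M * (1 + (1 - q)^-1 ^+ n) * q ^+ m.+1.
Proof.
move=> r0 Fjet Fa FM /andP[q0 q1] wq.
have q01 : 0 < q < 1 by rewrite q0.
have FMdisc z : polydisc a r z -> cabs (F z) <= M.
  apply: maximum_principle => // [y /Fjet[c' /taylor_cts]|y j /Fjet[c' Fy]] //.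
  exact: taylor_has_jet Fy.
have M0 : 0 <= M by apply: le_trans (FMdisc a (polydisc_center a r0)); exact: cabs_ge0.
(* w is q times v, and v is in the polydisc of multiradius q r: one factor q serves
   to bound the Taylor polynomial at v, the other one in Schwarz' lemma *)
pose v := (q^-1%:C%C : C R) *: w.
have wE : w = (q%:C%C : C R) *: v.
  by rewrite /v scalerA -rmorphM mulfV ?gt_eqF // scale1r.
have vq j : cabs (v ord0 j) <= q * r ord0 j.
  rewrite mxE cabsM cabs_real ger0_norm ?invr_ge0 ?(ltW q0) //.
  by rewrite ler_pdivrMl // mulrA -expr2 wq.
have in_disc t : cabs t <= 1 -> polydisc a r (a + t *: v).
  move=> t1 j; rewrite mxE addrAC subrr add0r mxE cabsM.
  apply: (@le_trans _ _ (1 * cabs (v ord0 j))); first by rewrite ler_wpM2r ?cabs_ge0.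
  by rewrite mul1r (le_trans (vq j)) // ler_piMl // ltW.
pose g t := F (a + t *: v) - (line_poly c m v).[t].
have cK_le K : cabs (c K * cmonom v K) <= M * q ^+ mlength K.
  apply: le_trans (_ : cabs (c K) * rmonom r K * q ^+ mlength K <= _); last first.
    by apply: ler_wpM2r; [rewrite exprn_ge0 ?(ltW q0)|exact: (cauchy_estimate K r0 Fjet Fa FM)].
  rewrite cabsM -mulrA; apply: ler_wpM2l; first exact: cabs_ge0.
  rewrite /cmonom cabs_prod /rmonom /mlength -prodrXr -big_split /=.
  apply: ler_prod => j _; rewrite cabs_ge0 cabsX mulrC -exprMn.
  by rewrite lerXn2r ?nnegrE ?cabs_ge0 ?mulr_ge0 ?(ltW q0).
(* what the expansion of order m + 3 adds to that of order m, divided by t ^ (m + 1) *)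
pose p : {poly C R} := \sum_(K <- degs (m + 3) | (m < mlength K)%N)
  (c K * cmonom v K)%:P * 'X^(mlength K - m.+1).
have [] := @schwarz _ g m.+1 p (M * (1 + (1 - q)^-1 ^+ n)).
- move=> t t1; apply: has_jetD; last first.
    by apply: eq_has_jet (has_jet_poly (- line_poly c m v) t) => x; rewrite hornerN.
  by have [c' Ft] := Fjet _ (in_disc t t1); exact: taylor_has_jet_at Ft.
- have [B [d [_ d0 Fd]]] := taylor_line (m + 3) v Fa.
  exists B, d; split=> // h hd; rewrite -addSn in Fd; apply: le_trans (Fd h hd).
  rewrite le_eqVlt; apply/orP; left; apply/eqP; congr cabs.
  rewrite /g -addrA -opprD; congr (_ - _).
  rewrite [in RHS]/line_poly (bigID (fun K => mlength K <= m)%N) /= hornerD; congr (_ + _).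
    by rewrite -big_filter -(perm_big _ (perm_degs_degs (leq_addr 3 m))).
  rewrite /p !horner_sum mulr_sumr.
  apply: eq_big => [K|K mK]; first by rewrite ltnNge.
  by rewrite !hornerM !hornerC !hornerXn mulrCA -exprD subnKC.
- move=> t t1; apply: le_trans (cabsD _ _) _; rewrite cabsN mulrDr mulr1; apply: lerD.
    by apply: FMdisc; apply: in_disc; rewrite t1.
  apply: (@le_trans _ _ (M * \sum_(K <- degs m) q ^+ mlength K)); last first.
    by apply: ler_wpM2l => //; exact: sum_degs_le.
  rewrite /line_poly horner_sum; apply: le_trans (cabs_sum _ _ _) _.
  rewrite mulr_sumr; apply: ler_sum => K _.
  by rewrite hornerM hornerC hornerXn cabsM cabsX t1 expr1n mulr1 cK_le.
move=> _ /(_ q%:C%C); rewrite cabs_real gtr0_norm // => /(_ (ltW q1)).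
by rewrite /g horner_line_poly -wE.
Qed.

End CauchyEstimates.

(** * The ball, and suprema over tori *)

Section Ball.
Context {R : realType} {n : nat}.
Implicit Types (a z w : 'rV[C R]_n) (r s : 'rV[R]_n).

(** Minkowski's inequality. For positive [A] and [B] above the two norms, convexity of
    the square gives [(x_j + y_j) ^ 2 <= (A + B) * (x_j ^ 2 / A + y_j ^ 2 / B)]; add
    over [j]. *)
Lemma l2_triangle (x y : 'I_n -> R) :
  Num.sqrt (\sum_j (x j + y j) ^+ 2) <=
  Num.sqrt (\sum_j x j ^+ 2) + Num.sqrt (\sum_j y j ^+ 2).
Proof.
have sq_le (f : 'I_n -> R) (A : R) : 0 < A -> Num.sqrt (\sum_j f j ^+ 2) <= A ->
    \sum_j f j ^+ 2 <= A ^+ 2.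
  move=> A0 fA; rewrite -(@sqr_sqrtr _ (\sum_j _)); last first.
    by apply: sumr_ge0 => j _; rewrite sqr_ge0.
  by rewrite lerXn2r ?nnegrE ?sqrtr_ge0 ?(ltW A0).
apply/ler_addgt0Pr => e e0.
set A := Num.sqrt (\sum_j x j ^+ 2); set B := Num.sqrt (\sum_j y j ^+ 2).
have Ae : 0 < A + e / 2 by rewrite ltr_wpDl ?sqrtr_ge0 ?divr_gt0.
have Be : 0 < B + e / 2 by rewrite ltr_wpDl ?sqrtr_ge0 ?divr_gt0.
have -> : A + B + e = (A + e / 2) + (B + e / 2) by lra.
have xA : \sum_j x j ^+ 2 <= (A + e / 2) ^+ 2.
  by apply: sq_le => //; rewrite lerDl divr_ge0 // ltW.
have yB : \sum_j y j ^+ 2 <= (B + e / 2) ^+ 2.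
  by apply: sq_le => //; rewrite lerDl divr_ge0 // ltW.
move: (A + _) (B + _) Ae Be xA yB => {}A {}B A0 B0 xA yB.
have AB : 0 < A + B by rewrite addr_gt0.
rewrite -[leRHS]ger0_norm ?(ltW AB) // -sqrtr_sqr ler_wsqrtr //.
apply: (@le_trans _ _ ((A + B) * (A^-1 * \sum_j x j ^+ 2 + B^-1 * \sum_j y j ^+ 2))).
  rewrite !mulr_sumr -big_split /= mulr_sumr; apply: ler_sum => j _.
  rewrite -subr_ge0.
  have -> : (A + B) * (A^-1 * x j ^+ 2 + B^-1 * y j ^+ 2) - (x j + y j) ^+ 2 =
      (B * x j - A * y j) ^+ 2 / (A * B) by field; rewrite !gt_eqF.
  by rewrite divr_ge0 ?sqr_ge0 // mulr_ge0 // ltW.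
rewrite expr2 ler_pM2l //; apply: lerD.
  by rewrite ler_pdivrMl // -expr2.
by rewrite ler_pdivrMl // -expr2.
Qed.

Lemma polydisc_ball a r : (forall j, 0 <= r ord0 j) -> rnorm2 r < 1 - cnorm2 a ->
  polydisc a r `<=` @unit_ball R n.
Proof.
move=> r0 ra z za; rewrite /unit_ball /=.
apply: (@le_lt_trans _ _ (cnorm2 a + rnorm2 r)); last by rewrite addrC -ltrBrDr.
apply: le_trans (l2_triangle (fun j => cabs (a ord0 j)) (fun j => r ord0 j)).
apply: ler_wsqrtr; apply: ler_sum => j _.
rewrite lerXn2r ?nnegrE ?addr_ge0 ?cabs_ge0 //.
have -> : z ord0 j = a ord0 j + (z ord0 j - a ord0 j) by ring.
by apply: le_trans (cabsD _ _) _; rewrite lerD2l.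
Qed.

Lemma unit_ball_open a : unit_ball a -> exists2 d : R, 0 < d &
  forall w, (forall i, cabs (w ord0 i) <= d) -> unit_ball (a + w).
Proof.
rewrite /unit_ball /= -subr_gt0 => a1.
pose d := (1 - cnorm2 a) / (2 * n.+1%:R).
have d0 : 0 < d by rewrite divr_gt0 // mulr_gt0.
exists d => // w wd; apply: (@polydisc_ball a (const_mx d)) => [j||j]; last 1 first.
- by rewrite !mxE addrAC subrr add0r.
- by rewrite mxE ltW.
rewrite /rnorm2; under eq_bigr do rewrite mxE.
rewrite sumr_const card_ord.
apply: (@le_lt_trans _ _ (n.+1%:R * d)).
  have -> : n.+1%:R * d = Num.sqrt ((n.+1%:R * d) ^+ 2).
    by rewrite sqrtr_sqr ger0_norm // mulr_ge0 // ltW.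
  rewrite ler_wsqrtr //.
  rewrite [leRHS]exprMn -[leLHS]mulr_natl ler_wpM2r ?sqr_ge0 // -natrX ler_nat.
  by rewrite (leq_trans (leqnSn n)) // expnS leq_pmulr ?expn_gt0.
have -> : n.+1%:R * d = (1 - cnorm2 a) / 2.
  by rewrite /d invfM mulrCA (mulrCA n.+1%:R) mulfV ?pnatr_eq0 // mulr1.
by lra.
Qed.

(** Compactness of the polydisc makes the set of moduli on the torus bounded. *)
Lemma maxmod_ub F a r : (forall j, 0 <= r ord0 j) ->
  (forall z, polydisc a r z -> cts F z) ->
  forall z, torus a r z -> cabs (F z) <= maxmod r a F.
Proof.
move=> r0 Fcts z zT.
have [|||b /set_mem bP bmax] := @compact_EVT_max _ R (fun z => cabs (F z)) (polydisc a r).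
- by exists a; exact: polydisc_center.
- exact: compact_polydisc.
- apply: continuous_in_subspaceT => y /set_mem yP.
  exact: cts_continuous_cabs (Fcts y yP).
rewrite /maxmod; apply: sup_upper_bound; last by exists z.
split; first by exists (cabs (F z)), z.
exists (cabs (F b)) => _ [y yT <-]; apply: bmax; apply: mem_set => j.
by rewrite yT.
Qed.

Lemma maxmod_le F a r (M : R) : (forall j, 0 <= r ord0 j) ->
  (forall z, torus a r z -> cabs (F z) <= M) -> maxmod r a F <= M.
Proof.
move=> r0 FM; apply: ge_sup; last by move=> _ [z zT <-]; exact: FM.
exists (cabs (F (a + map_mx (fun x => x%:C%C) r))); eexists; last by [].
by move=> j; rewrite !mxE addrAC subrr add0r cabs_real ger0_norm.
Qed.

End Ball.

(** * Bounded index *)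

Section Numbers.
Context {R : realType}.

Lemma uniform_lt1 n (f : 'I_n -> R) : (forall j, f j < 1) ->
  exists2 t : R, 0 < t < 1 & forall j, f j <= t.
Proof.
move=> f1; exists (\big[Num.max/2^-1]_j f j); last by move=> j; exact: le_bigmax.
apply/andP; split; first by rewrite (lt_le_trans _ (bigmax_ge_id _ _ _ _)).
apply: bigmax_lt => //; by rewrite invf_lt1 // ltr1n.
Qed.

Lemma small_power (q e : R) : 0 < q < 1 -> 0 < e -> exists N, forall m, (N <= m)%N -> q ^+ m <= e.
Proof.
move=> /andP[q0 q1] e0.
have : `|q| < 1 by rewrite gtr0_norm.
move=> /cvg_expr /cvgrPdist_lt /(_ e e0)[N _ NP]; exists N => m mN.
have := NP m mN; rewrite sub0r normrN ger0_norm ?exprn_ge0 ?(ltW q0) //.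
exact: ltW.
Qed.

End Numbers.

Section Monomials.
Context {R : realType} {n : nat}.
Implicit Types (r s : 'rV[R]_n) (K : mindex n).

Lemma rmonom_vdiv r s K : rmonom (vdiv r s) K = rmonom r K / rmonom s K.
Proof.
rewrite /rmonom -prodf_div; apply: eq_bigr => j _.
by rewrite mxE expr_div_n.
Qed.

Lemma rmonom_gt0 r K : (forall j, 0 < r ord0 j) -> 0 < rmonom r K.
Proof. by move=> r0; apply: prodr_gt0 => j _; rewrite exprn_gt0. Qed.

End Monomials.

Theorem theorem6 (R : realType) (n : nat) (n_gt0 : (0 < n)%N)
  (beta : R) (beta_gt : Num.sqrt n%:R < beta)
  (L : 'rV[C R]_n -> 'rV[R]_n) (LQ : classQ beta L)
  (F : 'rV[C R]_n -> C R) (F_analytic : analytic_on (@unit_ball R n) F)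
  (hM : exists (R' R'' : 'rV[R]_n) (p1 : R),
    [/\ forall j : 'I_n, 0 < R' ord0 j < 1,
        forall j : 'I_n, 1 < R'' ord0 j,
        rnorm2 R'' <= beta,
        1 <= p1 &
        forall z0 : 'rV[C R]_n, unit_ball z0 ->
          maxmod (vdiv R'' (L z0)) z0 F <=
            p1 * maxmod (vdiv R' (L z0)) z0 F]) :
  bounded_index L F.
Proof.
have [R' [R'' [p1 [R'01 R''1 R''beta p11 maxF]]]] := hM.
have [_ L_gt _] := LQ.
have beta0 : 0 < beta by rewrite (le_lt_trans _ beta_gt) // sqrtr_ge0.
have R''0 j : 0 < R'' ord0 j by rewrite (lt_trans _ (R''1 j)).
have [c Fc] : exists c, taylor_on (@unit_ball R n) F c.
  have ex_c a : exists ca, unit_ball a -> taylor F a ca.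
    have [aB|aB] := pselect (unit_ball a).
      by have [ca Fa] := analytic_taylor F_analytic aB; exists ca.
    by exists (fun=> 0).
  by have [c Fc] := choice ex_c; exists c => a; exact: Fc.
(* t, hence q and e, bound the ratios of radii uniformly in the point of the ball *)
have [t /andP[t0 t1] R't] : exists2 t : R, 0 < t < 1 & forall j, R' ord0 j / R'' ord0 j <= t.
  apply: uniform_lt1 => j; rewrite ltr_pdivrMr // mul1r (lt_trans _ (R''1 j)) //.
  by have /andP[] := R'01 j.
have [e /andP[e0 e1] R''e] : exists2 e : R, 0 < e < 1 & forall j, (R'' ord0 j)^-1 <= e.
  by apply: uniform_lt1 => j; rewrite invf_lt1.
pose q := Num.sqrt t.
have q2 : q ^+ 2 = t by rewrite sqr_sqrtr // ltW.
have q01 : 0 < q < 1 by rewrite sqrtr_gt0 t0 -sqrtr1 ltr_sqrt.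
pose G := 1 + (1 - q)^-1 ^+ n.
have G0 : 0 < G.
  by have /andP[_ q1] := q01; rewrite ltr_pwDl // exprn_ge0 // invr_ge0 subr_ge0 ltW.
have p10 : 0 < p1 by rewrite (lt_le_trans _ p11).
(* the remainder of order m0 will be absorbed by the left-hand side of the hypothesis *)
have [m0 small_q] : exists m0, p1 * (G * q ^+ m0.+1) <= 2^-1.
  have pG : 0 < 2^-1 / (p1 * G) by rewrite divr_gt0 ?mulr_gt0.
  have [N NP] := small_power q01 pG.
  exists N; have := NP N.+1 (leqnSn N).
  by rewrite ler_pdivlMr ?mulr_gt0 // mulrC mulrA.
(* the entries of R' are below 1, so a sum over degs m0 is at most its size times its
   largest mu *)
pose A := 2 * p1 * (size (@degs n m0))%:R.
have A0 : 0 <= A by rewrite !mulr_ge0 // ltW.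
have [m1 small_e] : exists m1, forall m, (m1 <= m)%N -> A * e ^+ m <= 1.
  have e01 : 0 < e < 1 by rewrite e0.
  have A1 : 0 < (1 + A)^-1 by rewrite invr_gt0 ltr_pwDl.
  have [N NP] := small_power e01 A1.
  exists N => m /NP; rewrite -[leRHS]mul1r ler_pdivlMr ?ltr_pwDl // mulrC.
  by apply: le_trans; rewrite mulrDl mul1r lerDr exprn_ge0 // ltW.
exists (maxn m0 m1) => z0 J z0B.
set l := L z0.
have z01 : 0 < 1 - cnorm2 z0 by rewrite subr_gt0.
have l_gt j : beta / (1 - cnorm2 z0) < l ord0 j by exact: L_gt.
have l0 j : 0 < l ord0 j by rewrite (lt_trans _ (l_gt j)) // divr_gt0.
pose mu K := cabs (c z0 K) / rmonom l K.
have muE K : index_term L F z0 K = mu K.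
  rewrite /index_term (mderive_taylor unit_ball_open Fc) // cabsM cabs_nat /mu.
  by rewrite -mulf_div mulfV ?mul1r // pnatr_eq0 -lt0n prodn_gt0 // => j; rewrite fact_gt0.
have mu0 K : 0 <= mu K by rewrite divr_ge0 ?cabs_ge0 // ltW // rmonom_gt0.
set X := \big[_/_]_(_ | _) _.
have mu_X K : (mlength K <= maxn m0 m1)%N -> mu K <= X.
  move=> Km; have : K \in box (maxn m0 m1).+1.
    by rewrite mem_box; apply/forallP => j; rewrite ltnS (leq_trans (le_mlength K j)).
  case/fintype.imageP => K' _ KE; rewrite -muE KE.
  by apply: (bigmax_sup K'); rewrite -?KE.
have X0 : 0 <= X by exact: bigmax_ge_id.
have r0 (r : 'rV[R]_n) j : 0 < r ord0 j -> 0 < vdiv r l ord0 j.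
  by move=> rj; rewrite mxE divr_gt0.
have r''0 j : 0 <= vdiv R'' l ord0 j by rewrite ltW ?r0.
have r'0 j : 0 <= vdiv R' l ord0 j by rewrite ltW ?r0 //; have /andP[] := R'01 j.
have sub_ball : polydisc z0 (vdiv R'' l) `<=` @unit_ball R n.
  apply: polydisc_ball => //.
  (* strict because l_j > beta / (1 - |z0|) for at least one j, as n > 0 *)
  have z02 : 0 <= (1 - cnorm2 z0) / beta by rewrite divr_ge0 ?ltW.
  apply: (@lt_le_trans _ _ ((1 - cnorm2 z0) / beta * rnorm2 R'')); last first.
    by rewrite mulrAC ler_pdivrMr // ler_wpM2l // ltW.
  rewrite /rnorm2 -[in ltRHS](ger0_norm z02) -sqrtr_sqr -sqrtrM ?sqr_ge0 // mulr_sumr.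
  have lt_j j : vdiv R'' l ord0 j ^+ 2 < ((1 - cnorm2 z0) / beta) ^+ 2 * R'' ord0 j ^+ 2.
    rewrite -exprMn ltrXn2r ?nnegrE ?mulr_ge0 ?(ltW (R''0 j)) // mxE mulrC ltr_pM2r //.
    by rewrite -invf_div ltf_pV2 ?posrE // divr_gt0.
  rewrite ltr_sqrt; last first.
    rewrite (bigD1 (Ordinal n_gt0)) //= ltr_pwDl //; last first.
      by apply: sumr_ge0 => j _; rewrite mulr_ge0 ?sqr_ge0.
    by rewrite mulr_gt0 ?exprn_gt0 // divr_gt0.
  rewrite (bigD1 (Ordinal n_gt0)) //= [ltRHS](bigD1 (Ordinal n_gt0)) //= ltr_leD //.
  by apply: ler_sum => j _; exact: ltW.
have Ftaylor z : polydisc z0 (vdiv R'' l) z -> exists c', taylor F z c'.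
  by move=> /sub_ball zB; exists (c z); exact: Fc.
have Fz0 := Fc z0 z0B.
set M := maxmod (vdiv R'' l) z0 F.
have FM z : torus z0 (vdiv R'' l) z -> cabs (F z) <= M.
  apply: maxmod_ub => // y /Ftaylor[c' Fy]; exact: taylor_cts Fy.
have M0 : 0 <= M.
  apply: le_trans (cauchy_estimate mindex0 r''0 Ftaylor Fz0 FM).
  by rewrite mulr_ge0 ?cabs_ge0 // ltW // rmonom_gt0 // => j; exact: r0.
have muM K : mu K <= M * e ^+ mlength K.
  have RK : 0 < rmonom R'' K by exact: rmonom_gt0.
  have := cauchy_estimate K r''0 Ftaylor Fz0 FM; rewrite rmonom_vdiv mulrCA mulrC -/(mu K).
  rewrite -ler_pdivlMr // => /le_trans; apply; apply: ler_wpM2l => //.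
  rewrite /rmonom /mlength -prodrXr -prodfV; apply: ler_prod => j _.
  rewrite invr_ge0 exprn_ge0 ?(ltW (R''0 j)) //= -exprVn.
  by rewrite lerXn2r ?nnegrE ?invr_ge0 ?(ltW e0) ?(ltW (R''0 j)).
have M'le : maxmod (vdiv R' l) z0 F <= \sum_(K <- degs m0) mu K + M * G * q ^+ m0.+1.
  apply: maxmod_le => // z zT.
  have wT j : cabs ((z - z0) ord0 j) = vdiv R' l ord0 j by rewrite -(zT j) !mxE.
  have -> : F z = taylor_poly (c z0) m0 (z - z0) +
      (F (z0 + (z - z0)) - taylor_poly (c z0) m0 (z - z0)).
    by rewrite (addrC z0) subrK addrC subrK.
  apply: le_trans (cabsD _ _) _; apply: lerD; last first.
    apply: (taylor_remainder (r := vdiv R'' l)) => // j.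
    rewrite wT q2 !mxE mulrA ler_wpM2r ?invr_ge0 ?(ltW (l0 j)) //.
    by rewrite -ler_pdivrMr.
  apply: le_trans (cabs_sum _ _ _) _; apply: ler_sum => K _.
  rewrite cabsM /mu; apply: ler_wpM2l; first exact: cabs_ge0.
  rewrite /cmonom cabs_prod /rmonom -prodfV; apply: ler_prod => j _.
  rewrite cabs_ge0 cabsX wT mxE expr_div_n ler_piMl ?invr_ge0 ?exprn_ge0 ?(ltW (l0 j)) //=.
  by have /andP[R'0 R'1] := R'01 j; rewrite exprn_ile1 // ltW.
have sum_X : \sum_(K <- @degs n m0) mu K <= (size (@degs n m0))%:R * X.
  have -> : (size (@degs n m0))%:R * X = \sum_(K <- @degs n m0) X.
    by rewrite big_const_seq count_predT iter_addr_0 mulr_natl.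
  rewrite big_seq [leRHS]big_seq; apply: ler_sum => K Km.
  by apply: mu_X; rewrite (leq_trans _ (leq_maxl _ _)) // -mem_degs.
have MX : M <= A * X.
  have pM := maxF z0 z0B; rewrite -/l -/M in pM.
  have := ler_wpM2l (ltW p10) M'le; have := ler_wpM2l (ltW p10) sum_X.
  have := ler_wpM2l M0 small_q; rewrite /A.
  lra.
rewrite muE; have [Jm|Jm] := leqP (mlength J) (maxn m0 m1); first exact: mu_X.
apply: le_trans (muM J) _.
apply: (@le_trans _ _ (A * X * e ^+ mlength J)); first by rewrite ler_wpM2r // exprn_ge0 // ltW.
rewrite mulrAC ler_piMl // small_e //.
by apply: leq_trans (ltnW Jm); exact: leq_maxr.
Qed.
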